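(* Let $\beta>1$ and let $\psi_1,\psi_2:\mathbb{N}\to\mathbb{R}^+$ be positive functions with $\underline{v}_1\ge 0$ and $\underline{v}_2\ge 0$. (a) If $\underline{v}_2>1$, then $\mathcal{L}(\psi_1)\cap\mathcal{U}(\psi_2)$ is countable. (b) If $\frac{\overline{v}_1}{2+\overline{v}_1}\le\underline{v}_2\le 1<\overline{v}_2$, then $$0\le\dim_H\left(\mathcal{L}(\psi_1)\cap\mathcal{U}(\psi_2)\right)\le\min\left\{\frac{1}{1+\overline{v}_2},\ \left(\frac{1-\underline{v}_2}{1+\underline{v}_2}\right)^2\right\}.$$ (c) If $\frac{\underline{v}_1}{2+\underline{v}_1}<\underline{v}_2\le\overline{v}_2\le 1$ and $\frac{\overline{v}_1}{2+\overline{v}_1}<\overline{v}_2$, then $$\left(\frac{1-\overline{v}_2}{1+\overline{v}_2}\right)^2\le\dim_H\left(\mathcal{L}(\psi_1)\cap\mathcal{U}(\psi_2)\right)\le\min\left\{\frac{1}{1+\overline{v}_2},\ \left(\frac{1-\underline{v}_2}{1+\underline{v}_2}\right)^2\right\}.$$ (d) If $\underline{v}_2\le\frac{\underline{v}_1}{2+\underline{v}_1}$ and $\frac{\overline{v}_1}{2+\overline{v}_1}<\overline{v}_2\le 1$, then $$\left(\frac{1-\overline{v}_2}{1+\overline{v}_2}\right)^2\le\dim_H\left(\mathcal{L}(\psi_1)\cap\mathcal{U}(\psi_2)\right)\le\frac{\underline{v}_1-\underline{v}_2-\underline{v}_1\underline{v}_2}{(1+\underline{v}_1)(\underline{v}_1-\underline{v}_2)}.$$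 (e) If $\frac{\underline{v}_1}{2+\underline{v}_1}<\underline{v}_2\le\overline{v}_2\le\frac{\overline{v}_1}{2+\overline{v}_1}$, then $$\frac{\overline{v}_1-\overline{v}_2-\overline{v}_1\overline{v}_2}{(1+\overline{v}_1)(\overline{v}_1-\overline{v}_2)}\le\dim_H\left(\mathcal{L}(\psi_1)\cap\mathcal{U}(\psi_2)\right)\le\min\left\{\frac{1}{1+\overline{v}_2},\ \left(\frac{1-\underline{v}_2}{1+\underline{v}_2}\right)^2\right\}.$$ (f) If $\underline{v}_2\le\frac{\underline{v}_1}{2+\underline{v}_1}$ and $\overline{v}_2\le\frac{\overline{v}_1}{2+\overline{v}_1}$, then $$\frac{\overline{v}_1-\overline{v}_2-\overline{v}_1\overline{v}_2}{(1+\overline{v}_1)(\overline{v}_1-\overline{v}_2)}\le\dim_H\left(\mathcal{L}(\psi_1)\cap\mathcal{U}(\psi_2)\right)\le\frac{\underline{v}_1-\underline{v}_2-\underline{v}_1\underline{v}_2}{(1+\underline{v}_1)(\underline{v}_1-\underline{v}_2)}.$$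
   Context: For $\beta>1$, the $\beta$-transformation is $T_\beta(x)=\beta x-\lfloor\beta x\rfloor$ for $x\in[0,1)$, extended by $T_\beta(1)=\beta-\lfloor\beta\rfloor$; $T_\beta^n$ is its $n$-th iterate ($T_\beta^0 x=x$). For positive functions $\psi_1,\psi_2:\mathbb{N}\to\mathbb{R}^+$ define $$\mathcal{L}(\psi_1)=\{x\in[0,1]: T_\beta^n x<\psi_1(n)\text{ for infinitely many } n\in\mathbb{N}\},$$ $$\mathcal{U}(\psi_2)=\{x\in[0,1]: \text{for all sufficiently large integers } N \text{ there is an integer } n\in[0,N] \text{ with } T_\beta^n x<\psi_2(N)\}.$$ For $i=1,2$ put $$\underline{v}_i=\liminf_{n\to\infty}\frac{-\log_\beta\psi_i(n)}{n},\qquad \overline{v}_i=\limsup_{n\to\infty}\frac{-\log_\beta\psi_i(n)}{n},$$ which may equal $+\infty$. $\dim_H$ denotes Hausdorff dimension. Conventions for degenerate values (limits): $\frac{a}{2+a}=1$ if $a=\infty$; $\frac{1}{1+a}=0$ if $a=\infty$; and for $0\le b\le\frac{a}{2+a}$, the expression $\frac{a-b-ab}{(1+a)(a-b)}$ is read as $0$ if $a=\infty$ and as $1$ if $a=b=0$. *)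

(* Defs.v *)
From HB Require Import structures.
From mathcomp Require Import all_boot all_order all_algebra.
From mathcomp Require Import all_classical all_reals all_analysis.
Import Order.TTheory GRing.Theory Num.Theory.
Import numFieldNormedType.Exports.

Set Implicit Arguments.
Unset Strict Implicit.
Unset Printing Implicit Defensive.

Local Open Scope classical_set_scope.
Local Open Scope ring_scope.

Section HausdorffDimension.
Context {R : realType}.
Implicit Types (E A : set R) (s d : R).

(* The diameter of the empty set is -oo here; diam is only used on nonempty
   sets or in upper bounds [diam E <= d]. *)
Definition diam E : \bar R :=
  ereal_sup [set `|p.1 - p.2|%:E | p in E `*` E].

(* With the conventions 0^0 = 1 and (diam set0)^s = 0, also for s = 0, so that
   the 0-dimensional Hausdorff measure is the counting measure. *)
Definition diam_pow s E : \bar R :=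
  if E == set0 then 0%E else poweR (diam E) s.

(* Sequences indexed by nat also represent finite covers, as the members of a
   cover may be empty. *)
Definition hausdorff_content s d A : \bar R :=
  ereal_inf [set (\sum_(0 <= i <oo) diam_pow s (E i))%E | E in
    [set E : nat -> set R |
      A `<=` \bigcup_i E i /\ forall i, (diam (E i) <= d%:E)%E]].

Definition hausdorff_measure s A : \bar R :=
  ereal_sup [set hausdorff_content s d A | d in [set d | 0 < d]].

Definition hausdorff_dim A : \bar R :=
  ereal_inf [set s%:E | s in [set s | 0 <= s /\ hausdorff_measure s A = 0%E]].

End HausdorffDimension.

Section BetaTransformation.
Context {R : realType}.
Implicit Types (beta x : R) (psi : nat -> R).

(* Only used for x in [0, 1]; at x = 1 it is beta - floor beta. *)
Definition beta_trans beta x : R := beta * x - (Num.floor (beta * x))%:~R.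

Definition asymp_set beta psi : set R :=
  [set x | x \in `[0, 1] /\
    infinite_set [set n | iter n (beta_trans beta) x < psi n]].

Definition unif_set beta psi : set R :=
  [set x | x \in `[0, 1] /\
    \forall N \near \oo,
      exists2 n : nat, (n <= N)%N & iter n (beta_trans beta) x < psi N].

(* The junk value at n = 0 (division by 0) does not affect the limits. *)
Definition decay_rate beta psi (n : nat) : \bar R :=
  (- (ln (psi n) / ln beta) / n%:R)%:E.

Definition lower_rate beta psi : \bar R := limn_einf (decay_rate beta psi).
Definition upper_rate beta psi : \bar R := limn_esup (decay_rate beta psi).

End BetaTransformation.

(* These functions of extended reals are only used on [0, +oo]: the values at
   +oo are the limits, those at -oo are junk. *)
Section Bounds.
Context {R : realType}.
Implicit Types a b v : \bar R.

Definition threshold a : R :=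
  match a with
  | r%:E%E => r / (2 + r)
  | +oo%E => 1
  | -oo%E => 0
  end.

Definition inv1p a : R :=
  match a with
  | r%:E%E => 1 / (1 + r)
  | +oo%E => 0
  | -oo%E => 0
  end.

(* Only used for 0 <= v <= 1. *)
Definition unif_bound v : R := ((1 - fine v) / (1 + fine v)) ^+ 2.

(* Only used for 0 <= b <= threshold a, so that b is finite, and a - b vanishes
   only at a = b = 0. *)
Definition joint_bound a b : R :=
  match a, b with
  | r%:E%E, t%:E%E =>
      if (r == 0) && (t == 0) then 1
      else (r - t - r * t) / ((1 + r) * (r - t))
  | _, _ => 0
  end.

End Bounds.

(* Main.v *)
Require Import Defs.
From mathcomp Require Import all_boot all_order all_algebra.
From mathcomp Require Import all_classical all_reals all_analysis.
From mathcomp Require Import ring lra zify.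
Import Order.TTheory GRing.Theory Num.Theory.
Import numFieldNormedType.Exports.

(** Why the bounds hold.

Write [T] for the transformation. When [T^n x < beta^-b], the [b] digits of [x]
after the first [n] vanish, so the asymptotic and the uniform exponents of [x]
are read off the positions and lengths of the runs of zeros in its expansion. If
the exponents are [v] and [w], the runs starting at [n] have length at most
about [v * n], and before every time [n] there is a run of length at least about
[w * n]. The rates of [psi1] and [psi2] bound these exponents, and all the
bounds on dimensions are values and limits of the function [joint_dim v w = (v -
w - v w) / ((1 + v) (v - w))]. For fixed [w] it is largest, with value [((1 - w)
/ (1 + w))^2], at [v = 2 w / (1 - w)], and it decreases afterwards
([joint_dim_le_unif], [joint_dim_antitone]); the thresholds of the theorem say
on which side of this maximum [v] lies.

Upper bounds. Going backwards from a nonzero digit at position [n], the runs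
forced by uniform approximation occupy a proportion [q = v w / (v - w)] of the
first [n] digits ([free_digits_le]). After a run of length [v * n] starting at
[n], only [(1 - q) * n] of the [(1 + v) * n] digits have been free, and the
quotient is [joint_dim v w]. Words are cut into blocks, each made of free digits
followed by zeros. As there are at most [C * beta^k] words of length [k]
([lendpoint_list]), there are about [beta^F] words with [F] free digits; blocks
being long, the choice of their boundaries is negligible ([size_parsed_list]).
Hence points that infinitely often have at most [s * m] free digits among the
first [m] form a set of dimension at most [s] ([hausdorff_dim_parsed]). Uniform
approximation with an exponent greater than [1] would make the runs overlap, so
that only the countably many points whose orbit reaches [0] remain.

Lower bounds. Inserting zeros at prescribed positions into the expansion of any
[y] in [0, 1) gives an admissible sequence for every [beta], because tails only
become smaller. With blocks of zeros at [n_k], of length about [v * n_k = w *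
n_(k+1)], the new numbers have exponents at least [v] and [w]. Deleting the
zeros again is Hölder continuous of any exponent [s < joint_dim v w]
([insert_zeros_holder]) and maps onto [0, 1), which has positive length, so the
dimension is at least [s] ([hausdorff_dim_ge_holder]). *)

Set Implicit Arguments.
Unset Strict Implicit.
Unset Printing Implicit Defensive.

Local Open Scope classical_set_scope.
Local Open Scope ring_scope.

(** * Hausdorff dimension *)

Section HausdorffDimensionBounds.
Context {R : realType}.
Implicit Types (E A : set R) (s d : R).

Lemma diam_pow_ge0 s E : (0 <= diam_pow s E)%E.
Proof. by rewrite /diam_pow; case: ifP => // _; exact: poweR_ge0. Qed.

Lemma diam_pow0 s : diam_pow s (@set0 R) = 0%E.
Proof. by rewrite /diam_pow eqxx. Qed.

Lemma diam0 : diam (@set0 R) = -oo%E.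
Proof. by rewrite /diam set0X image_set0 ereal_sup0. Qed.

Lemma diam_ge0 E : E != set0 -> (0 <= diam E)%E.
Proof.
case/set0P => x Ex; apply: le_ereal_sup_tmp; exists `|x - x|%:E.
  by exists (x, x).
by rewrite subrr normr0.
Qed.

Lemma le_diam E x y : E x -> E y -> (`|x - y|%:E <= diam E)%E.
Proof. by move=> Ex Ey; apply: ereal_sup_ubound; exists (x, y). Qed.

Lemma diam_le E (l : R) :
  (forall x y, E x -> E y -> `|x - y| <= l) -> (diam E <= l%:E)%E.
Proof.
move=> El; apply: ge_ereal_sup => _ [[x y]] [/= Ex Ey] <-.
by rewrite lee_fin El.
Qed.

Lemma diam_itv (p l : R) : 0 <= l -> (diam `[p, (p + l)%R]%classic <= l%:E)%E.
Proof.
move=> l0; apply: diam_le => x y /=; rewrite !in_itv /= => ? ?.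
by rewrite ler_norml; lra.
Qed.

Lemma diam_pow_itv s (p l : R) : 0 <= s -> 0 <= l ->
  (diam_pow s `[p, (p + l)%R]%classic <= (l `^ s)%:E)%E.
Proof.
move=> s0 l0; rewrite /diam_pow; case: ifPn => E0; first by rewrite lee_fin powR_ge0.
rewrite -poweR_EFin; apply: gt0_ler_poweR => //.
- by rewrite in_itv /= leey andbT diam_ge0.
- by rewrite in_itv /= leey andbT lee_fin.
- exact: diam_itv.
Qed.

Lemma hausdorff_content_ge0 s d A : (0 <= hausdorff_content s d A)%E.
Proof.
apply: le_ereal_inf_tmp => _ [E _ <-].
by apply: nneseries_ge0 => *; exact: diam_pow_ge0.
Qed.

Lemma hausdorff_dim_ge0 A : (0 <= hausdorff_dim A)%E.
Proof. by apply: le_ereal_inf_tmp => _ [s [s0 _] <-]; rewrite lee_fin. Qed.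

Lemma hausdorff_content_double_cover s d A (E : nat -> nat -> set R) :
  A `<=` \bigcup_m \bigcup_i E m i ->
  (forall m i, (diam (E m i) <= d%:E)%E) ->
  (hausdorff_content s d A <=
     \sum_(0 <= m <oo) \sum_(0 <= i <oo) diam_pow s (E m i))%E.
Proof.
move=> AE Ed; have /card_esym/ppcard_eqP[f] := card_nat2.
have Epow_ge0 (k : nat * nat) : (0 <= diam_pow s (E k.1 k.2))%E by exact: diam_pow_ge0.
apply: ge_ereal_inf.
exists (\sum_(0 <= n <oo) diam_pow s (E (f n).1 (f n).2))%E.
  exists (fun n => E (f n).1 (f n).2) => //; split=> [x /AE[m _ [i _ Ex]]|i]; last exact: Ed.
  by exists (f^-1%FUN (m, i)) => //=; rewrite invK ?inE.
rewrite nneseries_esumT//.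
rewrite -(@reindex_esum R _ _ setT setT f (fun k => diam_pow s (E k.1 k.2)))//.
rewrite nneseries_esumT; last by move=> m; apply: nneseries_ge0 => *; exact: diam_pow_ge0.
under [leRHS]eq_esum => m _.
  rewrite nneseries_esumT; last by move=> *; exact: diam_pow_ge0.
  over.
rewrite esum_esum; last by move=> *; exact: diam_pow_ge0.
by rewrite (_ : _ `*`` _ = setT)//; apply/seteqP; split.
Qed.

Lemma hausdorff_dim_le s A : 0 <= s ->
  (forall s', s < s' -> hausdorff_measure s' A = 0%E) ->
  (hausdorff_dim A <= s%:E)%E.
Proof.
move=> s0 As; apply/lee_addgt0Pr => e e0; apply: ge_ereal_inf.
exists (s + e)%:E; last by rewrite EFinD.
by exists (s + e) => //; split; [lra|apply: As; lra].
Qed.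

Lemma near_expr_le (z eps : R) : 0 <= z < 1 -> 0 < eps ->
  \forall m \near \oo, z ^+ m <= eps.
Proof.
move=> z01 eps0; have /cvgr_dist_le/(_ _ eps0) : (z ^+ n) @[n --> \oo] --> 0.
  by apply: cvg_expr; rewrite ger0_norm; lra.
by apply: filterS => m; rewrite sub0r normrN; apply: le_trans; rewrite ler_norm.
Qed.

(** If every point of [A] lies in intervals of infinitely many levels [m], the
intervals of the levels [m >= m0] form a cover for every [m0].  Its weight is
bounded by the tail of a geometric series and its mesh by [r ^+ m0]. *)
Lemma hausdorff_measure_limsup_cover A s r rho (L : nat -> seq R) :
  0 <= s -> 0 < r < 1 -> 0 <= rho < 1 ->
  (forall m, (size (L m))%:R * (r ^+ m) `^ s <= rho ^+ m) ->
  (forall x, A x -> forall m0, exists m, (m0 <= m)%N /\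
     exists2 p, p \in L m & p <= x <= p + r ^+ m) ->
  hausdorff_measure s A = 0%E.
Proof.
move=> s0 /andP[r0 r1] /andP[rho0 rho1] Lsize Acov.
have rm0 m : 0 < r ^+ m by rewrite exprn_gt0.
apply/eqP; rewrite eq_le; apply/andP; split; last first.
  apply: le_ereal_sup_tmp; exists (hausdorff_content s 1 A); last exact: hausdorff_content_ge0.
  by exists 1 => //=.
apply: ge_ereal_sup => _ [d /= d0 <-].
suff bnd m0 : r ^+ m0 <= d ->
    (hausdorff_content s d A <= (rho ^+ m0 / (1 - rho))%:E)%E.
  apply/lee_addgt0Pr => e e0; rewrite add0e.
  have: \forall m \near \oo, r ^+ m <= d /\ rho ^+ m / (1 - rho) <= e.
    have h1 : \forall m \near \oo, r ^+ m <= d by apply: near_expr_le => //; lra.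
    have h2 : \forall m \near \oo, rho ^+ m <= e * (1 - rho).
      by apply: near_expr_le; [lra|apply: mulr_gt0 => //; lra].
    apply: filterS2 h1 h2 => m -> h; split => //.
    by rewrite ler_pdivrMr //; lra.
  case=> m0 _ /(_ m0 (leqnn _)) [rd rhoe].
  by apply: le_trans (bnd m0 rd) _; rewrite lee_fin.
move=> rd.
pose E m i : set R := if (m0 <= m)%N && (i < size (L m))%N
  then `[nth 0 (L m) i, (nth 0 (L m) i + r ^+ m)%R]%classic else set0.
have Ed m i : (diam (E m i) <= d%:E)%E.
  rewrite /E; case: ifPn => [/andP[m0m _]|_]; last by rewrite diam0 leNye.
  apply: le_trans (diam_itv _ (ltW (rm0 m))) _; rewrite lee_fin.
  apply: le_trans rd; rewrite -(subnK m0m) exprD ler_piMl ?exprn_ge0 //; first exact: ltW.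
  by apply: exprn_ile1; lra.
have AE : A `<=` \bigcup_m \bigcup_i E m i.
  move=> x Ax; have [m [m0m [p pL px]]] := Acov x Ax m0.
  exists m => //; exists (index p (L m)) => //.
  by rewrite /E m0m index_mem pL /= nth_index //= in_itv.
apply: le_trans (hausdorff_content_double_cover s AE Ed) _.
have Erow m : (\sum_(0 <= i <oo) diam_pow s (E m i) <=
    (if (m0 <= m)%N then rho ^+ m else 0)%:E)%E.
  rewrite (nneseries_split 0 (size (L m))); last by move=> *; exact: diam_pow_ge0.
  rewrite add0n [X in (_ + X)%E]eseries0 ?adde0; last first.
    by move=> i Li _; rewrite /E ltnNge Li andbF diam_pow0.
  have [m0m|m0m] := leqP m0 m; last first.
    rewrite big1 // => i _.
    by rewrite /E leqNgt m0m diam_pow0.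
  apply: le_trans (_ : \sum_(0 <= i < size (L m)) ((r ^+ m) `^ s)%:E <= _)%E.
    apply: lee_sum => i _; rewrite /E; case: ifP => _; last by rewrite diam_pow0 lee_fin powR_ge0.
    by apply: diam_pow_itv => //; exact: ltW.
  by rewrite sumEFin lee_fin sumr_const_nat subn0 -mulr_natl.
apply: le_trans (lee_nneseries _ (fun m _ => Erow m)) _.
  by move=> m _ _; apply: nneseries_ge0 => *; exact: diam_pow_ge0.
rewrite (nneseries_split 0 m0); last by move=> m _; case: ifP => _; rewrite lee_fin ?exprn_ge0.
rewrite add0n big_nat big1 ?add0e; last by move=> m /= m0m; rewrite leqNgt m0m.
apply: lime_le.
  by apply: is_cvg_nneseries => m _ _; case: ifP => _; rewrite lee_fin ?exprn_ge0.
apply: nearW => n; rewrite sumEFin lee_fin.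
have [m0n|nm0] := leqP m0 n; last first.
  by rewrite big_geq ?divr_ge0 ?exprn_ge0 //; [lra|exact: ltnW].
rewrite (eq_big_nat _ _ (F2 := fun m => rho ^+ m)); last by move=> m /andP[-> _].
have -> : \sum_(m0 <= m < n) rho ^+ m = (rho ^+ m0 - rho ^+ n) / (1 - rho).
  apply/(mulIf (x := 1 - rho)); first lra.
  rewrite divfK; last lra.
  rewrite mulr_suml (@telescope_sumr_eq _ _ _ (fun k => - rho ^+ k)) //; first by ring.
  by move=> k _; rewrite exprSr; ring.
by rewrite ler_pM2r ?invr_gt0 ?subr_gt0 // lerBlDr lerDl exprn_ge0.
Qed.

(** A cover of [A] pulls back along [phi] to a cover of [0, 1).  The condition
on [phi] says that its inverse is Hölder continuous of exponent [s], so a set of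
diameter [l] pulls back into an interval of length [2 * C * l `^ s], and these
lengths add up to at least [1].  Lebesgue measure on [0, 1) thus plays the
role of a mass distribution on [A]. *)
Lemma hausdorff_dim_ge_holder A (phi : R -> R) (C s : R) : 0 < s -> 0 < C ->
  (forall y : R, 0 <= y < 1 -> A (phi y)) ->
  (forall y y' : R, 0 <= y < 1 -> 0 <= y' < 1 ->
     `|y - y'| <= C * `|phi y - phi y'| `^ s) ->
  (s%:E <= hausdorff_dim A)%E.
Proof.
move=> s0 C0 Aphi phi_holder; apply: le_ereal_inf_tmp => _ [s' [s'0 As'] <-].
rewrite lee_fin leNgt; apply/negP => s's.
have cont0 : (hausdorff_content s' 1 A < ((4 * C)^-1)%:E)%E.
  apply: le_lt_trans (_ : 0%E < _)%E; last by rewrite lte_fin invr_gt0; lra.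
  by rewrite -As'; apply: ereal_sup_ubound; exists 1 => //=.
have [_ [E [AE Ed] <-]] := ereal_inf_lt cont0.
have /choice[I HI] : forall i, exists I : set R, [/\ measurable I,
    (lebesgue_measure I <= (2 * C)%:E * diam_pow s' (E i))%E &
    [set y | 0 <= y < 1 /\ E i (phi y)] `<=` I].
  move=> i; have [[y0 [y001 Ey0]]|noy] := pselect (exists y, 0 <= y < 1 /\ E i (phi y)); last first.
    exists set0; split => // [|y Hy]; last by exfalso; apply: noy; exists y.
    by rewrite measure0 mule_ge0 ?diam_pow_ge0 ?lee_fin // mulr_ge0 // ltW.
  have Ei0 : E i != set0 by apply/set0P; exists (phi y0).
  have := diam_ge0 Ei0; have := Ed i.
  have diamE := @le_diam (E i).
  have -> : diam_pow s' (E i) = poweR (diam (E i)) s' by rewrite /diam_pow (negPf Ei0).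
  case: (diam (E i)) diamE => // l diamE; rewrite !lee_fin => l1 l0.
  exists `[y0 - C * l `^ s, y0 + C * l `^ s]%classic; split.
  - exact: measurable_itv.
  - rewrite lebesgue_measure_itv /= lte_fin; case: ifPn => _.
      rewrite -EFinB -EFinM lee_fin.
      have -> : y0 + C * l `^ s - (y0 - C * l `^ s) = 2 * C * l `^ s by ring.
      rewrite ler_pM2l; last lra.
      move: l0; rewrite le_eqVlt => /predU1P[<-|l0]; last first.
        by apply: ger_powR; [rewrite l0|exact: ltW].
      by rewrite powR0 ?powR_ge0 // gt_eqF.
    by rewrite mule_ge0 ?lee_fin ?powR_ge0 // mulr_ge0 // ltW.
  - move=> y [y01 Ey] /=; rewrite in_itv /= -ler_distl.
    apply: le_trans (phi_holder _ _ y01 y001) _; rewrite ler_pM2l //.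
    apply: ge0_ler_powR; rewrite ?nnegrE ?normr_ge0 //; first exact: ltW.
    by rewrite -lee_fin; exact: diamE.
move=> sumE.
pose U := [set y : R | 0 <= y < 1].
have I01 : U `<=` \bigcup_i I i.
  move=> y y01; have [i _ Ey] := AE _ (Aphi _ y01).
  by exists i => //; have [_ _] := HI i; apply.
have m01 : U = `[0, 1[%classic.
  by apply/seteqP; split => y /=; rewrite in_itv.
have : (1 <= \sum_(0 <= i <oo) lebesgue_measure (I i))%E.
  apply: le_trans (_ : lebesgue_measure U <= _)%E.
    by rewrite m01 lebesgue_measure_itv /= lte_fin ltr01 oppr0 adde0.
  apply: (measure_sigma_subadditive lebesgue_measure) => //.
  - by move=> i; have [] := HI i.
  - by rewrite m01; exact: measurable_itv.
apply/negP; rewrite -ltNge.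
apply: le_lt_trans (_ : \sum_(0 <= i <oo) (2 * C)%:E * diam_pow s' (E i) < _)%E.
  by apply: lee_nneseries => // i _; have [] := HI i.
rewrite nneseriesZl; last by move=> *; exact: diam_pow_ge0.
have C2 : 0 < 2 * C by lra.
apply: (@le_lt_trans _ _ ((2 * C)%:E * ((4 * C)^-1)%:E)%E).
  by rewrite lee_pmul2l //; exact: ltW.
rewrite -EFinM lte_fin ltr_pdivrMr; lra.
Qed.
End HausdorffDimensionBounds.

(** * Orbits and cylinders *)

Section BetaExpansions.
Context {R : realType} (beta : R).
Hypothesis beta_gt1 : 1 < beta.
Implicit Types (x y t : R) (n m : nat).

Local Notation T := (beta_trans beta).

Let beta_gt0 : 0 < beta. Proof. exact: lt_trans beta_gt1. Qed.
Let betaX_gt0 n : 0 < beta ^+ n. Proof. exact: exprn_gt0. Qed.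
Let betaX_neq0 n : beta ^+ n != 0. Proof. exact: lt0r_neq0. Qed.

Definition digit x : nat := Num.truncn (beta * x).

Lemma beta_trans_itv x : 0 <= T x < 1.
Proof.
rewrite /beta_trans; have := floor_itv (beta * x).
by rewrite intrD => /andP[? ?]; apply/andP; split; lra.
Qed.

Lemma beta_trans_def x n y : beta * x = n%:R + y -> 0 <= y < 1 -> T x = y.
Proof.
move=> xE /andP[y0 y1]; rewrite /beta_trans xE.
rewrite (@floor_def _ (n%:R + y) n); first by rewrite -pmulrn addrAC subrr add0r.
by rewrite intrD -pmulrn; apply/andP; split; lra.
Qed.

Lemma mul_beta_digit x : 0 <= x -> beta * x = (digit x)%:R + T x.
Proof.
move=> x0; have bx0 : 0 <= beta * x by rewrite mulr_ge0 // ltW.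
have /andP[d1 d2] := truncn_itv bx0.
rewrite (@beta_trans_def x (digit x) (beta * x - (digit x)%:R)); first ring.
- by ring.
- by move: d1 d2; rewrite -natr1 -/(digit x) => ? ?; apply/andP; split; lra.
Qed.

Lemma iter_beta_trans_itv x n : 0 <= x <= 1 -> 0 <= iter n T x <= 1.
Proof.
by case: n => [|n] // _; have := beta_trans_itv (iter n T x); rewrite /=; lra.
Qed.

Lemma iter_beta_trans_ge0 x n : 0 <= x -> 0 <= iter n T x.
Proof. by case: n => [|n] // _; have := beta_trans_itv (iter n T x); rewrite /=; lra. Qed.

Lemma iter_beta_transD m n x : iter (m + n) T x = iter n T (iter m T x).
Proof. by rewrite addnC iterD. Qed.

(** A small orbit point is followed by a run of zero digits, during which the
transformation is multiplication by [beta]. *)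
Lemma iter_beta_trans_run x n : 0 <= x -> beta ^+ n * x < 1 ->
  iter n T x = beta ^+ n * x.
Proof.
move=> x0; elim: n => [|n IH]; first by rewrite mul1r.
rewrite exprS -mulrA => bx1.
have y0 : 0 <= beta ^+ n * x by rewrite mulr_ge0 // ltW.
have IH' : iter n T x = beta ^+ n * x.
  by apply: IH; apply: le_lt_trans bx1; rewrite ler_peMl // ltW.
rewrite iterS IH' (@beta_trans_def _ 0 (beta * (beta ^+ n * x))) ?add0r //.
by rewrite bx1 mulr_ge0 // ltW.
Qed.

(** The left endpoint of the cylinder of order [n] that contains [x]: the number
whose digits are the first [n] digits of [x].  It stands for that word. *)
Definition lendpoint n x := x - iter n T x / beta ^+ n.

Lemma lendpointD m n x :
  lendpoint (m + n) x = lendpoint m x + lendpoint n (iter m T x) / beta ^+ m.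
Proof.
rewrite /lendpoint iter_beta_transD exprD; field.
by rewrite !betaX_neq0.
Qed.

Lemma lendpointS n x : 0 <= x ->
  lendpoint n.+1 x = ((digit x)%:R + lendpoint n (T x)) / beta.
Proof.
move=> x0; rewrite -add1n lendpointD expr1 [RHS]mulrDl; congr (_ + _).
by rewrite /lendpoint iterS expr1 -{1}(mulKf (lt0r_neq0 beta_gt0) x) (mul_beta_digit x0); ring.
Qed.

Lemma lendpoint_ge0 n x : 0 <= x -> 0 <= lendpoint n x.
Proof.
elim: n x => [|n IH] x x0; first by rewrite /lendpoint expr0 divr1 subrr.
have /andP[Tx0 _] := beta_trans_itv x.
rewrite lendpointS //; apply: divr_ge0; last exact: ltW.
by apply: addr_ge0; [exact: ler0n|exact: IH].
Qed.

Lemma lendpoint_itv n x : 0 <= x <= 1 -> lendpoint n x <= x <= lendpoint n x + (beta^-1) ^+ n.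
Proof.
move=> x01; have /andP[y0 y1] := iter_beta_trans_itv n x01.
rewrite /lendpoint exprVn; set y := iter n T x in y0 y1 *.
have : 0 <= y / beta ^+ n by rewrite divr_ge0 // ltW.
have : y / beta ^+ n <= (beta ^+ n)^-1 by rewrite ler_piMl // invr_ge0 ltW.
lra.
Qed.

Lemma lendpoint_run a b x : iter (a + b) T x = beta ^+ b * iter a T x ->
  lendpoint (a + b) x = lendpoint a x.
Proof.
by rewrite /lendpoint exprD => ->; congr (_ - _); field; rewrite !betaX_neq0.
Qed.

(** A cylinder contains every point between its left endpoint and any of its
points, because replacing the tail [T^n x] by a smaller one keeps the sequence
of digits admissible. *)
Lemma iter_lendpoint_add n x t : 0 <= x -> 0 <= t <= iter n T x ->
  iter n T (lendpoint n x + t / beta ^+ n) = t.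
Proof.
elim: n x => [|n IH] x x0; first by rewrite /lendpoint expr0 !divr1 subrr add0r.
rewrite iterSr => /andP[t0 tTx]; have /andP[Tx0 Tx1] := beta_trans_itv x.
set y := _ + _; pose z := lendpoint n (T x) + t / beta ^+ n.
have zE : beta * y = (digit x)%:R + z.
  rewrite /y /z lendpointS // exprS; field.
  by rewrite betaX_neq0 lt0r_neq0.
have z01 : 0 <= z < 1.
  apply/andP; split.
    apply: addr_ge0; first exact: lendpoint_ge0.
    by apply: divr_ge0 => //; exact: ltW.
  apply: le_lt_trans Tx1; rewrite /z /lendpoint -addrA gerDl addrC -mulrBl.
  by rewrite pmulr_lle0 ?invr_gt0 // subr_le0.
by rewrite iterSr (beta_trans_def zE z01) IH // t0.
Qed.
End BetaExpansions.

(** * The number of cylinders *)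

(** [lia] on the hypotheses about [nat] only, as real-valued terms slow it down. *)
Ltac nat_lia :=
  repeat match goal with
  | H : ?P |- _ => lazymatch P with
    | is_true (leq _ _) => fail
    | is_true (leq _ _ && leq _ _) => fail
    | @eq nat _ _ => fail
    | nat => fail
    | _ => clear H
    end
  end; lia.

Section Counting.
Context {R : realType}.

(** Distinct points of [A] have distinct values of [Num.truncn (p / delta)]. *)
Lemma separated_list (A : set R) (delta : R) : 0 < delta ->
  (forall p, A p -> 0 <= p <= 1) ->
  (forall p q, A p -> A q -> p < q -> delta <= q - p) ->
  exists2 s : seq R, (size s)%:R <= delta^-1 + 1 & forall p, A p -> p \in s.
Proof.
move=> d0 A01 Asep.
have scale_ge0 p : A p -> 0 <= p / delta.
  by move=> /A01/andP[p0 _]; rewrite divr_ge0 // ltW.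
pose rep j := xget 0 [set p | A p /\ Num.truncn (p / delta) = j].
exists [seq rep j | j <- iota 0 (Num.truncn delta^-1).+1].
  rewrite size_map size_iota -natr1 lerD2r.
  by have /andP[] := truncn_itv (ltW (etrans (invr_gt0 delta) d0)).
move=> p Ap; have /andP[p0 p1] := A01 _ Ap.
have -> : p = rep (Num.truncn (p / delta)).
  set q := rep _; have [Aq qp] : A q /\ Num.truncn (q / delta) = Num.truncn (p / delta).
    by apply: (@xgetPex _ 0 [set q | A q /\ Num.truncn (q / delta) = _]); exists p.
  have /andP[+ +] := truncn_itv (scale_ge0 _ Aq); rewrite qp.
  have /andP[+ +] := truncn_itv (scale_ge0 _ Ap); rewrite -natr1 => lp up lq uq.
  have close (a b : R) : a / delta < b / delta + 1 -> a - b < delta.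
    by rewrite -(ltr_pM2r d0) mulrDl !divfK ?lt0r_neq0 // mul1r; lra.
  have [pq|qp'|//] := ltgtP p q.
  - by have := Asep _ _ Ap Aq pq; have := close q p; lra.
  - by have := Asep _ _ Aq Ap qp'; have := close p q; lra.
apply: map_f; rewrite mem_iota add0n ltnS /=; apply: le_truncn.
by rewrite ler_piMl // invr_ge0 ltW.
Qed.

Variable beta : R.
Hypothesis b1 : 1 < beta.
Local Notation T := (beta_trans beta).

Let beta_gt0 : 0 < beta. Proof. exact: lt_trans b1. Qed.
Let betaX_gt0 n : 0 < beta ^+ n. Proof. exact: exprn_gt0. Qed.
Let betaX_neq0 n : beta ^+ n != 0. Proof. exact: lt0r_neq0. Qed.

(** The hypotheses on [q] say that its last nonzero digit is the [n + 1]-st one.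
Lowering this digit by one shows that the cylinder of order [n + 1] just below
[q] is full: its length is [beta ^- n.+1], and it contains no left endpoint
other than its own. *)
Lemma lendpoint_gap n (p q : R) : 0 <= q -> p < q ->
  iter n.+1 T p = 0 -> iter n.+1 T q = 0 -> iter n T q != 0 ->
  (beta ^+ n.+1)^-1 <= q - p.
Proof.
move=> q0 pq Tp Tq Tq0; rewrite leNgt; apply/negP => gap.
pose u := beta ^+ n * (q - p).
have bu0 : 0 < beta * u by rewrite !mulr_gt0 // subr_gt0.
have bu1 : beta * u < 1.
  by rewrite /u mulrA -exprS mulrC -ltr_pdivlMr // div1r.
have y0 : 0 <= iter n T q by exact: iter_beta_trans_ge0.
have := mul_beta_digit b1 y0; rewrite -iterS Tq addr0 => yE.
have dig_gt0 : (1 : R) <= (digit beta (iter n T q))%:R.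
  rewrite ler1n lt0n; apply: contra Tq0 => /eqP d0.
  by move/eqP: yE; rewrite d0 mulf_eq0 (gt_eqF beta_gt0).
pose t := iter n T q - u.
have btE : beta * t = (digit beta (iter n T q))%:R - beta * u by rewrite mulrBr yE.
have t0 : 0 <= t by rewrite -(pmulr_rge0 _ beta_gt0) btE; lra.
have Tnp : iter n T p = t.
  rewrite (_ : p = lendpoint beta n q + t / beta ^+ n); last first.
    by rewrite /lendpoint /t /u; field.
  apply: iter_lendpoint_add => //; rewrite t0 /t gerBl.
  by rewrite -(pmulr_rge0 _ beta_gt0) ltW.
have := mul_beta_digit b1 t0; rewrite -[X in T X]Tnp -iterS Tp addr0 btE => dE.
have : (digit beta t < digit beta (iter n T q))%N by rewrite -(ltr_nat R); lra.
have : (digit beta (iter n T q) < (digit beta t).+1)%N by rewrite -(ltr_nat R) -natr1; lra.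
nat_lia.
Qed.

(** Rényi's bound on the number of admissible words, up to the constant. Words
are counted through the left endpoints of their cylinders.  An endpoint of level
[n + 1] that is not one of level [n] has a full cylinder on its left, so such
endpoints are [beta ^- n.+1]-separated, and there are about [beta ^+ n.+1] of
them. *)
Lemma lendpoint_list : exists2 C : R, 0 < C &
  forall n, exists2 s : seq R, (size s)%:R <= C * beta ^+ n &
    forall x, 0 <= x <= 1 -> lendpoint beta n x \in s.
Proof.
pose C := 2 * beta / (beta - 1).
have b10 : 0 < beta - 1 by rewrite subr_gt0.
have C2 : 2 <= C by rewrite /C ler_pdivlMr //; lra.
exists C; first lra.
elim=> [|n [s sC sP]].
  exists [:: 0] => [|x _]; first by rewrite expr0 mulr1 /=; lra.
  by rewrite /lendpoint expr0 divr1 subrr inE.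
pose A : set R := [set p | 0 <= p <= 1 /\ iter n.+1 T p = 0 /\ iter n T p != 0].
have [s' s'C s'P] : exists2 s' : seq R, (size s')%:R <= beta ^+ n.+1 + 1 &
    forall p, A p -> p \in s'.
  rewrite -[X in X + 1]invrK; apply: separated_list; first by rewrite invr_gt0.
  - by move=> p [].
  - move=> p q [_ [Tp _]] [/andP[q0 _] [Tq Tq0]] pq; exact: lendpoint_gap.
exists (s ++ s') => [|x x01].
  rewrite size_cat natrD.
  have : 1 <= beta ^+ n.+1 by rewrite exprn_ege1 // ltW.
  have -> : C * beta ^+ n.+1 = C * beta ^+ n + 2 * beta ^+ n.+1.
    by rewrite /C exprS; field; rewrite subr_eq0 gt_eqF.
  by lra.
set p := lendpoint beta n.+1 x; have /andP[x0 x1] := x01.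
have p0 : 0 <= p by exact: lendpoint_ge0.
have p1 : p <= 1.
  apply: le_trans x1; rewrite /p /lendpoint gerBl divr_ge0 ?(ltW (betaX_gt0 _)) //.
  exact: iter_beta_trans_ge0.
have Tp : iter n.+1 T p = 0.
  rewrite -[p]addr0 -[X in _ + X](mul0r (beta ^+ n.+1)^-1).
  by apply: iter_lendpoint_add => //; rewrite lexx iter_beta_trans_ge0.
rewrite mem_cat; have [Tnp|Tnp] := eqVneq (iter n T p) 0.
  have -> : p = lendpoint beta n p by rewrite /lendpoint Tnp mul0r subr0.
  by rewrite sP ?p0.
by rewrite [p \in s']s'P ?orbT //; split => //; rewrite p0.
Qed.
End Counting.

(** * Words made of free digits and zeros *)

Section BlockParsing.
Context {R : realType}.
Variable beta : R.
Hypothesis b1 : 1 < beta.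
Local Notation T := (beta_trans beta).
Local Notation lendpoint := (lendpoint beta).

Let beta_gt0 : 0 < beta. Proof. exact: lt_trans b1. Qed.
Let betaX_gt0 n : 0 < beta ^+ n. Proof. exact: exprn_gt0. Qed.

(** The word of the first [m] digits of [x] is cut into blocks, each a free word
followed by zeros.  [F] is only an upper bound for the number of free digits, so
that words can be counted for one value of [F] at a time. *)
Inductive parsed (M : nat) (x : R) : nat -> nat -> Prop :=
| parsed0 F : parsed M x 0 F
| parsed_block m F a b : parsed M x m F -> (M <= a + b)%N ->
    iter (m + a + b) T x = beta ^+ b * iter (m + a) T x ->
    parsed M x (m + a + b) (F + a).

Lemma parsed_le M x m F F' : (F <= F')%N -> parsed M x m F -> parsed M x m F'.
Proof.
move=> FF' p; elim: p F' FF' => [{}F F' _|{}m {}F a b _ IH Mab run F' FF'].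
  exact: parsed0.
by rewrite (_ : F' = F' - a + a)%N; [apply: parsed_block => //; apply: IH|]; nat_lia.
Qed.

(** Left endpoints of order [m] with a parsing into at most [n] blocks; [D k]
lists the left endpoints of order [k].  The condition [0 < M] makes [n := m]
large enough. *)
Fixpoint parsed_list (D : nat -> seq R) (M n m F : nat) : seq R :=
  if n is n'.+1 then
    if m is 0 then [:: 0] else
    flatten [seq flatten [seq
      if ((M <= a + b) && (a + b <= m) && (a <= F))%N then
        [seq p + q / beta ^+ (m - a - b) | p <- parsed_list D M n' (m - a - b) (F - a), q <- D a]
      else [::] | b <- iota 0 m.+1] | a <- iota 0 F.+1]
  else [:: 0].

Lemma mem_parsed_list (D : nat -> seq R) M n m F x :
  (forall k y, 0 <= y <= 1 -> lendpoint k y \in D k) ->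
  0 <= x <= 1 -> (0 < M)%N -> (m <= n)%N -> parsed M x m F ->
  lendpoint m x \in parsed_list D M n m F.
Proof.
move=> DP x01 M0 mn p; elim: p n mn => [{}F|{}m {}F a b pm IH Mab run] n mn.
  by case: n mn => [|n] _ /=; rewrite /lendpoint expr0 divr1 subrr inE.
case: n mn => [|n] mn; first by nat_lia.
rewrite /parsed_list -/parsed_list; case mabE : (m + a + b)%N => [|k]; first by nat_lia.
rewrite -mabE; apply/flatten_mapP; exists a; first by rewrite mem_iota; nat_lia.
apply/flatten_mapP; exists b; first by rewrite mem_iota; nat_lia.
rewrite ifT; last by nat_lia.
rewrite addnK (_ : m + a + b - a - b = m)%N; last by nat_lia.
apply/allpairsP; exists (lendpoint m x, lendpoint a (iter m T x)); split => /=.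
- by apply: IH; nat_lia.
- by apply: DP; exact: iter_beta_trans_itv.
- by rewrite -addnA lendpointD // lendpoint_run // -!iter_beta_transD addnA.
Qed.

Lemma size_flatten_map (I S : Type) (f : I -> seq S) (s : seq I) :
  size (flatten [seq f i | i <- s]) = (\sum_(i <- s) size (f i))%N.
Proof. by rewrite size_flatten sumnE !big_map. Qed.

Lemma geometric_sum_le (r : R) n : 0 <= r < 1 ->
  \sum_(i <- iota 0 n) r ^+ i <= (1 - r)^-1.
Proof.
move=> /andP[r0 r1]; have r10 : 0 < 1 - r by rewrite subr_gt0.
have -> : \sum_(i <- iota 0 n) r ^+ i = (1 - r ^+ n) / (1 - r).
  apply: (mulIf (lt0r_neq0 r10)); rewrite divfK ?lt0r_neq0 //.
  have -> : iota 0 n = index_iota 0 n by rewrite /index_iota subn0.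
  rewrite mulr_suml (@telescope_sumr_eq _ _ _ (fun k => - r ^+ k)) //.
    by rewrite expr0; ring.
  by move=> k _; rewrite exprSr; ring.
by rewrite ler_piMl ?invr_ge0 ?(ltW r10) // lerBlDr lerDl exprn_ge0.
Qed.

(** The factor [r ^+ (2 * m)] pays for the choice of the block boundaries: one
factor [r ^+ (a + b)] makes the sum over the shapes of a block converge, and the
other one, at most [r ^+ M], makes that sum at most [1]. *)
Lemma size_parsed_list (D : nat -> seq R) (C r : R) M n m F : 0 < r < 1 ->
  (forall k, (size (D k))%:R <= C * beta ^+ k) -> 0 < C ->
  C * r ^+ M <= (1 - r) ^+ 2 ->
  (m <= n)%N -> (0 < M)%N ->
  (size (parsed_list D M n m F))%:R * r ^+ (2 * m) <= beta ^+ F.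
Proof.
move=> /andP[r0 r1] DC C0 CM + M0.
have r10 : 0 < 1 - r by rewrite subr_gt0.
have betaX_ge1 k : 1 <= beta ^+ k by rewrite exprn_ege1 // ltW.
elim: n m F => [|n IH] m F mn.
  have -> : m = 0%N by nat_lia.
  by rewrite muln0 expr0 mulr1.
case: m mn => [|m] mn; first by rewrite muln0 expr0 mulr1.
rewrite /parsed_list -/parsed_list size_flatten_map natr_sum mulr_suml.
suff bnd a b : (size (if ((M <= a + b) && (a + b <= m.+1) && (a <= F))%N then
        [seq p + q / beta ^+ (m.+1 - a - b) | p <- parsed_list D M n (m.+1 - a - b) (F - a), q <- D a]
      else [::]))%:R * r ^+ (2 * m.+1) <= C * r ^+ M * beta ^+ F * (r ^+ a * r ^+ b).
  apply: le_trans (_ : \sum_(a <- iota 0 F.+1) \sum_(b <- iota 0 m.+2)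
      C * r ^+ M * beta ^+ F * (r ^+ a * r ^+ b) <= _).
    apply: ler_sum => a _; rewrite size_flatten_map natr_sum mulr_suml.
    by apply: ler_sum => b _; exact: bnd.
  under eq_bigr do rewrite -mulr_sumr -mulr_sumr.
  rewrite -mulr_sumr -mulr_suml.
  set Sa := \sum_(i <- _) _; set Sb := \sum_(i <- _) _.
  have Sa1 : Sa <= (1 - r)^-1 by apply: geometric_sum_le; rewrite ltW.
  have Sb1 : Sb <= (1 - r)^-1 by apply: geometric_sum_le; rewrite ltW.
  have SaSb : Sa * Sb <= (1 - r)^-1 * (1 - r)^-1.
    by apply: ler_pM => //; apply: sumr_ge0 => i _; rewrite exprn_ge0 // ltW.
  apply: le_trans (_ : (1 - r) ^+ 2 * beta ^+ F * ((1 - r)^-1 * (1 - r)^-1) <= _).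
    apply: ler_pM => //.
    - by rewrite !mulr_ge0 ?exprn_ge0 // ltW.
    - by rewrite mulr_ge0 //; apply: sumr_ge0 => i _; rewrite exprn_ge0 // ltW.
    - by rewrite ler_pM2r.
  by rewrite le_eqVlt; apply/orP; left; apply/eqP; field; rewrite lt0r_neq0.
case: ifPn => [/andP[/andP[Mab abm] aF]|_]; last first.
  by rewrite mul0r !mulr_ge0 ?exprn_ge0 // ltW.
rewrite size_allpairs natrM.
have IH' := IH (m.+1 - a - b)%N (F - a)%N ltac:(nat_lia).
rewrite (_ : 2 * m.+1 = 2 * (m.+1 - a - b) + (a + b) + (a + b))%N; last by nat_lia.
rewrite 2!exprD.
have -> : C * r ^+ M * beta ^+ F * (r ^+ a * r ^+ b) =
   beta ^+ (F - a) * (C * beta ^+ a) * (r ^+ M * r ^+ (a + b)).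
  by rewrite exprD -{1}(subnK aF) exprD; ring.
set l := (size _)%:R in IH' *; set d := (size _)%:R.
have -> : l * d * (r ^+ (2 * (m.+1 - a - b)) * r ^+ (a + b) * r ^+ (a + b)) =
  l * r ^+ (2 * (m.+1 - a - b)) * d * (r ^+ (a + b) * r ^+ (a + b)) by ring.
have rX k : 0 < r ^+ k by rewrite exprn_gt0.
apply: ler_pM; rewrite ?mulr_ge0 ?exprn_ge0 ?ler0n ?(ltW r0) //.
  apply: ler_pM; [|exact: ler0n|exact: IH'|exact: DC]. by rewrite mulr_ge0 ?ler0n ?exprn_ge0 ?(ltW r0).
rewrite ler_pM2r //; apply: ler_wiXn2l => //; exact: ltW.
Qed.

(** A cylinder of order [m] has length at most [beta ^- m], and there are about
[beta ^+ F] words with at most [F] free digits.  With [F <= s1 * m] for an [s1]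
slightly above [s], the sum of the powers [s'] of the lengths is a geometric
series, the number of parsings being absorbed by [r ^+ (2 * m)]. *)
Lemma hausdorff_dim_parsed (A : set R) (s : R) : 0 <= s ->
  (forall x, A x -> 0 <= x <= 1) ->
  (forall x, A x -> forall s', s < s' -> forall M m0, exists m F,
     [/\ (m0 <= m)%N, F%:R <= s' * m%:R & parsed M x m F]) ->
  (hausdorff_dim A <= s%:E)%E.
Proof.
move=> s0 A01 Aparsed; apply: hausdorff_dim_le => // s' ss'.
(* One [e] of the gap between [s] and [s'] goes to [s1], two pay for the number
of parsings, and the last one makes the series converge. *)
pose e := (s' - s) / 4; have e0 : 0 < e by rewrite /e; lra.
have powbX (t : R) k : (beta `^ t) ^+ k = beta `^ (t * k%:R).
  by rewrite powRrM powR_mulrn // powR_ge0.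
have powb_le (t u : R) : t <= u -> beta `^ t <= beta `^ u.
  by apply: ler_powR; exact: ltW.
pose r := beta `^ (- e).
have r0 : 0 < r by exact: powR_gt0.
have r1 : r < 1.
  rewrite /r powRN invf_lt1 ?powR_gt0 //.
  have <- : 1 `^ e = 1 :> R by rewrite powR1.
  by apply: gt0_ltr_powR; rewrite ?nnegrE ?(ltW beta_gt0) ?ler01.
have r10 : 0 < 1 - r by rewrite subr_gt0.
have [C C0 Clist] := lendpoint_list b1.
have /choice[D HD] : forall n, exists l : seq R, (size l)%:R <= C * beta ^+ n /\
    forall x, 0 <= x <= 1 -> lendpoint n x \in l.
  by move=> n; have [l ? ?] := Clist n; exists l.
have [M0 _ /(_ _ (leqnn _)) HM0] : \forall m \near \oo, r ^+ m <= (1 - r) ^+ 2 / C.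
  by apply: near_expr_le; rewrite ?divr_gt0 ?exprn_gt0 // (ltW r0).
pose M := M0.+1.
have CM : C * r ^+ M <= (1 - r) ^+ 2.
  rewrite mulrC -ler_pdivlMr //; apply: le_trans HM0.
  by apply: ler_wiXn2l => //; exact: ltW.
pose s1 := s + e; have s10 : 0 <= s1 by rewrite /s1; lra.
pose L m := parsed_list D M m m (Num.truncn (s1 * m%:R)).
apply: (@hausdorff_measure_limsup_cover _ _ _ beta^-1 r L).
- lra.
- by rewrite invr_gt0 beta_gt0 invf_lt1.
- by rewrite ltW.
- move=> m; have rXm : 0 < r ^+ (2 * m) by rewrite exprn_gt0.
  rewrite -(ler_pM2r rXm) mulrAC.
  have := @size_parsed_list D C r M m m (Num.truncn (s1 * m%:R)) _ (fun k => (HD k).1) C0 CM (leqnn _) isT.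
  rewrite -/(L m) r0 r1 => /(_ isT) LF.
  apply: le_trans (_ : beta `^ (s1 * m%:R) * ((beta^-1) ^+ m) `^ s' <= _).
    rewrite ler_wpM2r ?powR_ge0 //; apply: le_trans LF _.
    rewrite -powR_mulrn ?(ltW beta_gt0) //; apply: powb_le.
    by have /andP[] := truncn_itv (mulr_ge0 s10 (ler0n R m)).
  rewrite exprVn -powR_invn ?(ltW beta_gt0) // -powRrM /r !powbX -!powRD; last 2 first.
  - by rewrite (gt_eqF beta_gt0) implybT.
  - by rewrite (gt_eqF beta_gt0) implybT.
  apply: powb_le; rewrite natrM /s1 /e; set k := m%:R; lra.
- move=> x Ax m0; have x01 := A01 _ Ax.
  have [m [F [m0m Fm pmF]]] := Aparsed x Ax s1 ltac:(rewrite /s1; lra) M m0.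
  exists m; split => //; exists (lendpoint m x); last exact: lendpoint_itv.
  apply: mem_parsed_list => //; first by move=> k; exact: (HD k).2.
  apply: parsed_le pmF; rewrite truncn_ge_nat // mulr_ge0 //.
Qed.
End BlockParsing.

(** * Runs of zeros along an orbit *)

Section ZeroRuns.
Context {R : realType}.
Variable beta : R.
Hypothesis b1 : 1 < beta.
Local Notation T := (beta_trans beta).
Local Notation parsed := (parsed beta).

Let beta_gt0 : 0 < beta. Proof. exact: lt_trans b1. Qed.
Let betaX_gt0 n : 0 < beta ^+ n. Proof. exact: exprn_gt0. Qed.
Let betaX_neq0 n : beta ^+ n != 0. Proof. exact: lt0r_neq0. Qed.

Lemma nat_mul_ge (a c : R) : 0 < a ->
  exists N : nat, forall n, (N <= n)%N -> c <= a * n%:R.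
Proof.
move=> a0; exists (Num.truncn (c / a)).+1 => n Nn.
rewrite -ler_pdivrMl // mulrC; apply: le_trans (ltW (truncnS_gt _)) _.
by rewrite ler_nat.
Qed.

Lemma nat_floor (y : R) : 0 <= y -> exists b : nat, b%:R <= y < b%:R + 1.
Proof. by move=> y0; exists (Num.truncn y); rewrite natr1 truncn_itv. Qed.

Lemma powb_le (t u : R) : t <= u -> beta `^ t <= beta `^ u.
Proof. by apply: ler_powR; exact: ltW. Qed.

Lemma powb_lt (t u : R) : t < u -> beta `^ t < beta `^ u.
Proof.
move=> tu; rewrite -[u](subrK t) powRD; last by rewrite (gt_eqF beta_gt0) implybT.
rewrite ltr_pMl ?powR_gt0 //.
have <- : 1 `^ (u - t) = 1 :> R by rewrite powR1.
by apply: gt0_ltr_powR; rewrite ?nnegrE ?(ltW beta_gt0) ?ler01 // subr_gt0.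
Qed.

(** Up to an arbitrarily small loss, [asymp_rate_ge x v] says that the asymptotic
exponent of [x] is at least [v], and [unif_rate_ge x w] that its uniform
exponent is at least [w]. *)
Definition asymp_rate_ge (x v : R) := forall n0 : nat, exists2 n : nat,
  (n0 <= n)%N & iter n T x < beta `^ (- (v * n%:R)).

Definition unif_rate_ge (x w : R) := exists N0 : nat, forall N, (N0 <= N)%N ->
  exists2 n : nat, (n <= N)%N & iter n T x < beta `^ (- (w * N%:R)).

Definition zero_run (x : R) (n b : nat) := iter (n + b) T x = beta ^+ b * iter n T x.

(** A maximal run of zeros can start at [n] only if the preceding digit is not
zero; there is no preceding digit when [n = 0]. *)
Definition run_start (x : R) (n : nat) : Prop :=
  if n is n'.+1 then iter n'.+1 T x <> beta * iter n' T x else True.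

Lemma asymp_rate_ge_le x v v' : v' <= v -> asymp_rate_ge x v -> asymp_rate_ge x v'.
Proof.
move=> v'v xv n0; have [n n0n xn] := xv n0; exists n => //.
by apply: lt_le_trans xn (powb_le _); rewrite lerN2 ler_wpM2r.
Qed.

Lemma asymp_rate_ge0 x : asymp_rate_ge x 0.
Proof.
move=> n0; exists n0.+1 => //; rewrite mul0r oppr0 powRr0.
by have /andP[] := beta_trans_itv beta (iter n0 T x).
Qed.

Lemma zero_run_of_small x n b u : 0 <= x -> iter n T x < beta `^ (- u) ->
  b%:R <= u -> zero_run x n b.
Proof.
move=> x0 xn bu; rewrite /zero_run iter_beta_transD iter_beta_trans_run //.
  exact: iter_beta_trans_ge0.
rewrite -ltr_pdivlMl // mulr1; apply: lt_le_trans xn _.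
by rewrite -powR_invn ?(ltW beta_gt0) //; apply: powb_le; rewrite lerN2.
Qed.

Lemma iter_beta_trans_le x n : 0 <= x -> iter n T x <= beta ^+ n * x.
Proof.
move=> x0; elim: n => [|n IH]; first by rewrite expr0 mul1r.
have y0 := iter_beta_trans_ge0 beta n x0.
apply: le_trans (_ : beta * iter n T x <= _).
  by rewrite iterS (mul_beta_digit b1 y0) lerDr.
by rewrite exprS -mulrA ler_pM2l.
Qed.

Lemma zero_run_sub x n b j : 0 <= x -> (j <= b)%N -> zero_run x n b -> zero_run x n j.
Proof.
move=> x0 jb run; have y0 := iter_beta_trans_ge0 beta n x0.
apply/eqP; rewrite eq_le iter_beta_transD iter_beta_trans_le //=.
have := iter_beta_trans_le (b - j) (iter_beta_trans_ge0 beta j y0).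
rewrite -iter_beta_transD subnKC // -iter_beta_transD run.
by rewrite -{1}(subnK jb) exprD -mulrA ler_pM2l.
Qed.

Lemma zero_run_cat x n b c : zero_run x n b -> zero_run x (n + b) c -> zero_run x n (b + c).
Proof. by rewrite /zero_run addnA => -> ->; rewrite exprD mulrCA mulrA. Qed.

Lemma run_start_lt x n k b : 0 <= x -> run_start x n -> (k < n)%N -> zero_run x k b ->
  (k + b < n)%N.
Proof.
move=> x0; case: n => // n /= nE kn run; rewrite ltnNge; apply/negP => nkb; apply: nE.
have h1 : zero_run x k (n.+1 - k) by apply: zero_run_sub run => //; nat_lia.
have h2 : zero_run x k (n - k) by apply: zero_run_sub run => //; nat_lia.
have kn2 : (k <= n)%N by [].
move: h1 h2; rewrite /zero_run (subnKC (ltnW kn)) (subnKC kn2) => h1 h2.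
rewrite -iterS h1 h2; by rewrite mulrA -exprS subSn.
Qed.

(** Moving the beginning of a run to the left as far as possible makes the run
longer and its position smaller, so that no exponent is lost. *)
Lemma run_start_extend x n : 0 <= x ->
  exists k, [/\ (k <= n)%N, run_start x k & zero_run x k (n - k)].
Proof.
move=> x0; have Pn : exists k, (k <= n)%N && `[< zero_run x k (n - k) >].
  by exists n; rewrite leqnn; apply/asboolP; rewrite /zero_run subnn addn0 expr0 mul1r.
have [k /andP[kn /asboolP run] kmin] := ex_minnP Pn; exists k; split => //.
case: k kn run kmin => // k kn run kmin /= kE.
suff : (k.+1 <= k)%N by rewrite ltnn.
apply: kmin; rewrite (ltnW kn); apply/asboolP.
have := run; rewrite /zero_run (subnKC kn) (subnKC (ltnW kn)) => ->.
by rewrite iterS kE mulrA -exprSr subnSK.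
Qed.

Lemma zero_run_iter_le x n b : 0 <= x -> zero_run x n b -> iter n T x <= iter (n + b) T x.
Proof.
move=> x0 ->; rewrite ler_peMl ?iter_beta_trans_ge0 //.
by rewrite exprn_ege1 // ltW.
Qed.

Lemma near_powb_le (v y : R) : 0 < v -> 0 < y ->
  exists N0 : nat, forall N, (N0 <= N)%N -> beta `^ (- (v * N%:R)) <= y.
Proof.
move=> v0 y0.
have [N0 _ HN0] : \forall m \near \oo, (beta `^ (- v)) ^+ m <= y.
  apply: near_expr_le => //; rewrite powR_ge0 /=.
  by rewrite -[ltRHS](powRr0 beta); apply: powb_lt; rewrite oppr_lt0.
exists N0 => N /HN0 /=; apply: le_trans.
by rewrite -powR_mulrn ?powR_ge0 // -powRrM mulNr.
Qed.

Section NonTerminating.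
Variable x : R.
Hypothesis x01 : 0 <= x <= 1.
Hypothesis xnz : forall n, iter n T x != 0.

Let x0 : 0 <= x. Proof. by case/andP: x01. Qed.
Let iter_gt0 n : 0 < iter n T x.
Proof. by rewrite lt_def xnz iter_beta_trans_ge0. Qed.

(** Each of the finitely many values [iter n T x] with [n < n0] is positive. *)
Lemma small_orbit_late (v : R) n0 : 0 < v -> exists N0 : nat, forall N n,
  (N0 <= N)%N -> iter n T x < beta `^ (- (v * N%:R)) -> (n0 <= n)%N.
Proof.
move=> v0; elim: n0 => [|n0 [N0 IH]]; first by exists 0%N.
have [N1 HN1] := near_powb_le v0 (iter_gt0 n0).
exists (maxn N0 N1) => N n NN xn; have n0n := IH N n ltac:(nat_lia) xn.
rewrite ltn_neqAle n0n andbT; apply/eqP => n0E.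
by move: xn; rewrite -n0E ltNge HN1 //; nat_lia.
Qed.

Lemma asymp_rate_ge_unif (v : R) : 0 < v ->
  (forall N0 : nat, exists N n : nat,
    [/\ (N0 <= N)%N, (n <= N)%N & iter n T x < beta `^ (- (v * N%:R))]) ->
  asymp_rate_ge x v.
Proof.
move=> v0 xv n0; have [N0 HN0] := small_orbit_late n0 v0.
have [N [n [N0N nN xn]]] := xv N0; exists n; first exact: HN0 xn.
by apply: lt_le_trans xn (powb_le _); rewrite lerN2 ler_pM2l // ler_nat.
Qed.

(** If no run starts after [n0], all the digits after [n0] vanish, and the orbit
grows by a factor [beta] at each step. *)
Lemma run_start_unbounded n0 : exists2 n, (n0 <= n)%N & run_start x n.
Proof.
apply: contrapT => nostart.
have run b : zero_run x n0 b.
  elim: b => [|b IH]; first by rewrite /zero_run addn0 expr0 mul1r.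
  rewrite -addn1; apply: zero_run_cat IH _; rewrite /zero_run addn1 expr1.
  by apply: contrapT => nE; apply: nostart; exists (n0 + b).+1 => //; rewrite -addnS leq_addr.
have y20 : 0 < iter n0 T x / 2 by rewrite divr_gt0.
have [N HN] := near_powb_le ltr01 y20.
have := HN N (leqnn _); rewrite mul1r powR_invn ?(ltW beta_gt0) // ler_pdivlMr //.
move=> hN; have /andP[_] := iter_beta_trans_itv beta (n0 + N) x01.
rewrite (run N); apply/negP; rewrite -ltNge.
apply: lt_le_trans (_ : beta ^+ N * (beta ^- N * 2) <= _); last by rewrite ler_pM2l.
by rewrite mulrA mulfV // mul1r ltr1n.
Qed.

(** Uniform approximation at time [n - 1] gives a run of length about [w' * n]
that starts before [n].  The [n]-th digit is not zero, so the whole run fits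
before [n].  The gap between [w] and [w'] absorbs the integer parts. *)
Lemma run_before_start (w w' : R) k0 : 0 <= w < w' -> unif_rate_ge x w' ->
  exists N : nat, forall n, (N <= n)%N -> run_start x n ->
  exists k b, [/\ (k0 <= k)%N, run_start x k, zero_run x k b & (k + b < n)%N] /\
    w * n%:R <= b%:R /\ iter k T x < beta `^ (- (w * n%:R)).
Proof.
move=> /andP[w0 ww'] [N0 xN0]; have w'0 : 0 < w' by lra.
have [N1 HN1] := small_orbit_late k0 w'0.
have w'w : 0 < w' - w by rewrite subr_gt0.
have [N2 HN2] := nat_mul_ge (w' + 1) w'w.
exists (maxn (maxn N0 N1) N2).+1 => n Nn nstart.
have nN2 : w' + 1 <= (w' - w) * n%:R by apply: HN2; nat_lia.
have n_gt0 : (0 < n)%N by nat_lia.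
have nE : n.-1%:R = n%:R - 1 :> R by rewrite -[in RHS](prednK n_gt0) -natr1 addrK.
have [n' n'n xn'] := xN0 n.-1 ltac:(nat_lia).
have [b /andP[bl bu]] := nat_floor (mulr_ge0 (ltW w'0) (ler0n R n.-1)).
have wnb : w * n%:R <= b%:R by move: bu; rewrite nE; lra.
have [k [kn' kstart run_kn']] := run_start_extend n' x0.
have run_n'b : zero_run x n' b by apply: zero_run_of_small xn' _.
have run_k : zero_run x k (n' - k + b).
  by apply: zero_run_cat run_kn' _; rewrite subnKC.
have xk : iter k T x <= iter n' T x.
  by have := zero_run_iter_le x0 run_kn'; rewrite subnKC.
exists k, (n' - k + b)%N; split; first split => //.
- by apply: (HN1 n.-1 k); [nat_lia|exact: le_lt_trans xk xn'].
- by apply: run_start_lt run_k => //; nat_lia.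
- split; first by apply: le_trans wnb _; rewrite ler_nat leq_addl.
  apply: le_lt_trans xk (lt_le_trans xn' (powb_le _)).
  by rewrite lerN2; apply: le_trans wnb bl.
Qed.

(** A run of length [w * n] that ends before [n] starts before [(1 - w) * n]. *)
Lemma asymp_rate_ge_of_unif (w w' : R) : 0 < w < w' -> unif_rate_ge x w' ->
  w < 1 /\ asymp_rate_ge x (w / (1 - w)).
Proof.
move=> /andP[w0 ww'] xw'.
have ww'0 : 0 <= w < w' by rewrite ltW.
have w1 : w < 1.
  have [N HN] := run_before_start 0 ww'0 xw'.
  have [n Nn nstart] := run_start_unbounded N.
  have [k [b [[_ _ _ kbn] [wnb _]]]] := HN n Nn nstart.
  have : b%:R < n%:R :> R by rewrite ltr_nat; nat_lia.
  have n0 : 0 < n%:R :> R by rewrite ltr0n; nat_lia.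
  by move=> bn; rewrite -(ltr_pM2r n0) mul1r; apply: le_lt_trans bn.
split=> // n0; have [N HN] := run_before_start n0 ww'0 xw'.
have [n Nn nstart] := run_start_unbounded N.
have [k [b [[n0k _ _ kbn] [wnb xk]]]] := HN n Nn nstart.
exists k => //; apply: lt_le_trans xk (powb_le _); rewrite lerN2.
have w10 : 0 < 1 - w by rewrite subr_gt0.
rewrite mulrAC ler_pdivrMr // mulrAC -mulrA ler_pM2l //.
have : (k + b)%:R <= n%:R :> R by rewrite ler_nat ltnW.
by rewrite natrD; lra.
Qed.

(** A single block: free digits up to [n], followed by a run of length [v * n]. *)
Lemma parsed_of_asymp (v s : R) : 0 <= v -> asymp_rate_ge x v -> 1 < s * (1 + v) ->
  forall M m0, exists m F, [/\ (m0 <= m)%N, F%:R <= s * m%:R & parsed M x m F].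
Proof.
move=> v0 xv sv M m0; have sv0 : 0 < s * (1 + v) - 1 by rewrite subr_gt0.
have s0 : 0 < s by rewrite -(@pmulr_lgt0 _ (1 + v)); lra.
have [n0 Hn0] := nat_mul_ge s sv0.
have [n nn0 xn] := xv (n0 + M + m0)%N.
have nbig : s <= (s * (1 + v) - 1) * n%:R by apply: Hn0; nat_lia.
have [b /andP[bl bu]] := nat_floor (mulr_ge0 v0 (ler0n R n)).
exists (0 + n + b)%N, (0 + n)%N; split; first nat_lia.
  rewrite !natrD; apply: le_trans (_ : s * (n%:R + (v * n%:R - 1)) <= _); first lra.
  by rewrite ler_pM2l //; lra.
apply: parsed_block; [exact: parsed0|nat_lia|].
exact: zero_run_of_small xn bl.
Qed.

(** The proportion [q] of zeros forced before a run start [n].  The last run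
before [n] has length [b >= w * n]; as runs starting at [k] are shorter than
[V * k], it starts at some [k >= b / V].  If [q * k] zeros are forced before
[k], there are [q * k + b >= (q / V + 1) * w * n] before [n], and the equation
on [q] says that this is [q * n].  The constant [C] pays for small [n]. *)
Lemma free_digits_le (V w w' q : R) M : 0 < w < w' -> 0 < V -> 
  unif_rate_ge x w' -> ~ asymp_rate_ge x V -> q * V = w * V + q * w -> 0 <= q ->
  exists C : R, forall n, run_start x n -> exists m F,
    [/\ parsed M x m F, (m <= n)%N & (F + (n - m))%:R <= (1 - q) * n%:R + C].
Proof.
move=> /andP[w0 ww'] V0 xw' xV qE q0.
have ww'0 : 0 <= w < w' by rewrite ltW.
have [k0 Hk0] : exists k0 : nat, forall k, (k0 <= k)%N -> beta `^ (- (V * k%:R)) <= iter k T x.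
  apply: contrapT => nk0; apply: xV => n0; apply: contrapT => nn; apply: nk0; exists n0 => k n0k.
  by rewrite leNgt; apply/negP => xk; apply: nn; exists k.
have run_le k b : (k0 <= k)%N -> zero_run x k b -> b%:R <= V * k%:R.
  move=> k0k run; have /andP[_] := iter_beta_trans_itv beta (k + b) x01.
  rewrite run leNgt => bx1; rewrite leNgt; apply: contra bx1 => Vb.
  apply: lt_le_trans (_ : beta ^+ b * beta `^ (- (V * k%:R)) <= _); last first.
    by rewrite ler_pM2l // Hk0.
  rewrite -powR_mulrn ?(ltW beta_gt0) // -powRD; last by rewrite (gt_eqF beta_gt0) implybT.
  by rewrite -[ltLHS](powRr0 beta); apply: powb_lt; rewrite subr_gt0.
have [N HN] := run_before_start k0 ww'0 xw'.
have [N2 HN2] := nat_mul_ge M%:R w0.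
have [N' NN' N2N'] : exists2 N', (N <= N')%N & (N2 <= N')%N.
  by exists (N + N2)%N; [exact: leq_addr|exact: leq_addl].
exists (q * N'%:R); elim/ltn_ind => n IH nstart.
have [nN'|N'n] := ltnP n N'.
  exists 0%N, 0%N; split => //; first exact: parsed0.
  rewrite subn0 add0n mulrBl mul1r -addrA lerDl addrC subr_ge0.
  by rewrite ler_wpM2l // ler_nat ltnW.
have [k [b [[k0k kstart run kbn] [wnb _]]]] := HN n ltac:(nat_lia) nstart.
have [m [F [pm mk Fk]]] := IH k ltac:(nat_lia) kstart.
have bV := run_le _ _ k0k run.
exists (m + (k - m) + b)%N, (F + (k - m))%N; split; last 2 first.
- by nat_lia.
- rewrite subnKC // natrD natrB ?(ltnW kbn) // natrD.
  suff : q * n%:R <= q * k%:R + b%:R by move: Fk; rewrite natrD; lra.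
  rewrite -(ler_pM2r V0) mulrAC qE.
  rewrite mulrDl mulrDl.
  have h1 : w * n%:R * V <= b%:R * V by rewrite ler_pM2r.
  have h2 : q * (w * n%:R) <= q * (V * k%:R) by rewrite ler_wpM2l //; exact: le_trans wnb bV.
  lra.
apply: parsed_block => //; last by rewrite subnKC.
suff : (M <= b)%N by nat_lia.
rewrite -(ler_nat R); apply: le_trans wnb; apply: HN2.
exact: leq_trans N2N' N'n.
Qed.

(** The proportion of free digits is smallest at the end of a long run: about
[(1 - q) * k] of them in a word of length [(1 + v) * k]. *)
Lemma parsed_of_asymp_unif (V w w' q v s : R) : 0 < w < w' -> 0 < V ->
  unif_rate_ge x w' -> ~ asymp_rate_ge x V -> q * V = w * V + q * w -> 0 <= q ->
  0 < v -> asymp_rate_ge x v -> 1 - q < s * (1 + v) -> 0 < s ->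
  forall M m0, exists m F, [/\ (m0 <= m)%N, F%:R <= s * m%:R & parsed M x m F].
Proof.
move=> w01 V0 xw' xV qE q0 v0 xv sv s0 M m0.
have [C HC] := free_digits_le M w01 V0 xw' xV qE q0.
have sv0 : 0 < s * (1 + v) - (1 - q) by rewrite subr_gt0.
have [N1 HN1] := nat_mul_ge (C + s) sv0.
have [N2 HN2] := nat_mul_ge (M%:R + 1) v0.
have [k0 [N1k0 N2k0 m0k0]] : exists k0, [/\ N1 <= k0, N2 <= k0 & m0 <= k0]%N.
  by exists (N1 + N2 + m0)%N; split; nat_lia.
have [N0 HN0] := small_orbit_late k0 v0.
have [n N0n xn] := xv N0.
have [k [kn kstart run_kn]] := run_start_extend n x0.
have k0k : (k0 <= k)%N.
  apply: (HN0 n) => //; apply: le_lt_trans xn.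
  by have := zero_run_iter_le x0 run_kn; rewrite subnKC.
have [b' /andP[bl bu]] := nat_floor (mulr_ge0 (ltW v0) (ler0n R n)).
have [b b'b run] : exists2 b, (b' <= b)%N & zero_run x k b.
  exists (n - k + b')%N; first exact: leq_addl.
  by apply: zero_run_cat run_kn _; rewrite subnKC //; exact: zero_run_of_small xn bl.
have kn' : k%:R <= n%:R :> R by rewrite ler_nat.
have vkb : v * k%:R - 1 <= b%:R.
  have : v * k%:R <= v * n%:R by rewrite ler_pM2l.
  have : b'%:R <= b%:R :> R by rewrite ler_nat.
  by lra.
have Ck : C + s <= (s * (1 + v) - (1 - q)) * k%:R.
  by apply: HN1; exact: leq_trans k0k.
have Mk : M%:R + 1 <= v * k%:R by apply: HN2; exact: leq_trans k0k.
have [m [F [pm mk Fk]]] := HC k kstart.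
exists (m + (k - m) + b)%N, (F + (k - m))%N; split.
- by nat_lia.
- rewrite subnKC // [in leRHS]natrD; apply: le_trans Fk _.
  apply: le_trans (_ : s * (k%:R + (v * k%:R - 1)) <= _); first lra.
  by rewrite ler_pM2l //; lra.
- apply: parsed_block => //; last by rewrite subnKC.
  suff : (M <= b)%N by nat_lia.
  by rewrite -(ler_nat R); lra.
Qed.

(** For [v >= w / (1 - w)], the dimension of the set of points with asymptotic
exponent [v] and uniform exponent [w]. *)
Definition joint_dim (v w : R) : R := (v - w - v * w) / ((1 + v) * (v - w)).

End NonTerminating.
End ZeroRuns.

(** * Upper bounds for the dimension *)

Section UpperBounds.
Context {R : realType}.
Variable beta : R.
Hypothesis b1 : 1 < beta.
Local Notation T := (beta_trans beta).
Local Notation parsed := (parsed beta).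
Local Notation asymp_rate_ge := (asymp_rate_ge beta).
Local Notation unif_rate_ge := (unif_rate_ge beta).

(** Up to a positive factor, the difference of the two sides is the square of
[(1 - w) * v - 2 * w]: the most favourable asymptotic exponent is
[2 * w / (1 - w)]. *)
Lemma joint_dim_le_unif (v w : R) : 0 < w < 1 -> w / (1 - w) <= v ->
  joint_dim v w <= ((1 - w) / (1 + w)) ^+ 2.
Proof.
move=> /andP[w0 w1]; have w10 : 0 < 1 - w by rewrite subr_gt0.
rewrite ler_pdivrMr // => wv.
have vw : 0 < v - w.
  by rewrite -(pmulr_lgt0 _ w10); have := mulr_gt0 w0 w0; lra.
rewrite expr_div_n ler_pdivlMr; last by rewrite exprn_gt0 // addr_gt0.
rewrite /joint_dim mulrAC ler_pdivrMr; last by rewrite mulr_gt0 //; lra.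
have := sqr_ge0 ((1 - w) * v - 2 * w); nra.
Qed.

(** Beyond the maximum at [2 * w / (1 - w)], the dimension decreases. *)
Lemma joint_dim_antitone (r v w : R) : 0 < w < 1 -> 2 * w / (1 - w) <= r -> r <= v ->
  joint_dim v w <= joint_dim r w.
Proof.
move=> /andP[w0 w1]; have w10 : 0 < 1 - w by rewrite subr_gt0.
rewrite ler_pdivrMr // => wr rv.
have wv : 2 * w <= v * (1 - w) by apply: le_trans wr _; rewrite ler_pM2r.
have rw : 0 < r - w by rewrite -(pmulr_lgt0 _ w10); have := mulr_gt0 w0 w0; lra.
have vw : 0 < v - w by lra.
rewrite /joint_dim ler_pdivrMr; last by rewrite mulr_gt0 //; lra.
rewrite mulrAC ler_pdivlMr; last by rewrite mulr_gt0 //; lra.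
have h : 0 <= (1 - w) * r * v - w * (v + r).
  have h1 : w * v * 2 <= (1 - w) * r * v by rewrite mulrAC; apply: ler_wpM2r; lra.
  have h2 : w * r * 2 <= (1 - w) * r * v.
    have -> : w * r * 2 = 2 * w * r by ring.
    have -> : (1 - w) * r * v = v * (1 - w) * r by ring.
    by apply: ler_wpM2r => //; lra.
  lra.
rewrite -subr_ge0.
have -> : (r - w - r * w) * ((1 + v) * (v - w)) - (v - w - v * w) * ((1 + r) * (r - w)) =
  (v - r) * ((1 - w) * r * v - w * (v + r)) by ring.
by rewrite mulr_ge0 // subr_ge0.
Qed.

Section Point.
Variable x : R.
Hypothesis x01 : 0 <= x <= 1.
Hypothesis xnz : forall n, iter n T x != 0.

(** The hypothesis is used at the asymptotic exponent of [x], which may depend on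
[x] because the covers do not refer to it.  If this exponent is infinite, a
single block suffices. *)
Lemma parsed_of_unif (w w' s : R) : 0 < w < w' -> unif_rate_ge x w' -> 0 < s ->
  (forall v, w / (1 - w) <= v -> (forall v', asymp_rate_ge x v' -> v' <= v) ->
     joint_dim v w < s) ->
  forall M m0, exists m F, [/\ (m0 <= m)%N, F%:R <= s * m%:R & parsed M x m F].
Proof.
move=> ww' xw' s0 joint_lt; have /andP[w0 _] := ww'.
have [w1 xw1] := asymp_rate_ge_of_unif b1 x01 xnz ww' xw'.
have w10 : 0 < 1 - w by rewrite subr_gt0.
have ww1 : 0 < w / (1 - w) by rewrite divr_gt0.
have [xbig|/existsNP[V /not_implyP[V0 xV]]] :=
    pselect (forall v, 0 <= v -> asymp_rate_ge x v).
  have v0 : 0 <= s^-1 by rewrite invr_ge0 ltW.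
  apply: (parsed_of_asymp b1 x01 v0 (xbig _ v0)).
  by rewrite mulrDr mulfV ?gt_eqF // mulr1 ltrDr.
pose S := [set v | asymp_rate_ge x v].
have SV : ubound S V.
  move=> v /= xv; rewrite leNgt; apply/negP => Vv; apply: xV.
  exact: asymp_rate_ge_le (ltW Vv) xv.
have supS : has_sup S by split; [exists (w / (1 - w))|exists V].
pose v := sup S.
have wv : w / (1 - w) <= v by apply: ub_le_sup => //; exists V.
have xv v' : v' < v -> asymp_rate_ge x v'.
  move=> v'v; have e0 : 0 < v - v' by rewrite subr_gt0.
  have [u Su] := sup_adherent e0 supS; rewrite opprB addrC subrK => v'u.
  exact: asymp_rate_ge_le (ltW v'u) Su.
have xNv v' : v < v' -> ~ asymp_rate_ge x v'.
  by move=> vv' xv'; have := ub_le_sup (ex_intro _ V SV) xv'; rewrite leNgt vv'.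
have := joint_lt v wv (fun v' xv' => ub_le_sup (ex_intro _ V SV) xv').
have v0 : 0 < v by exact: lt_le_trans wv.
have vw : 0 < v - w.
  move: wv; rewrite ler_pdivrMr // => wv.
  by rewrite -(pmulr_lgt0 _ w10); have := mulr_gt0 w0 w0; lra.
(* [q0] is the proportion of zeros forced by runs of relative length [v]. *)
pose q0 := w + w ^+ 2 / (v - w).
have -> : joint_dim v w = (1 - q0) / (1 + v).
  rewrite /joint_dim /q0; field; rewrite gt_eqF //=; lra.
rewrite ltr_pdivrMr; last lra.
move=> q0s; have wq0 : w < q0 by rewrite ltrDl divr_gt0 ?exprn_gt0.
(* [q] is slightly below [q0], so that [V'] is slightly above [v]. *)
pose q := (Num.max w (1 - s * (1 + v)) + q0) / 2.
have qE : [/\ w < q, 1 - s * (1 + v) < q & q < q0].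
  have h1 : w <= Num.max w (1 - s * (1 + v)) by rewrite le_max lexx.
  have h2 : 1 - s * (1 + v) <= Num.max w (1 - s * (1 + v)) by rewrite le_max lexx orbT.
  have h3 : Num.max w (1 - s * (1 + v)) < q0 by rewrite gt_max wq0 /=; lra.
  by rewrite /q; split; lra.
case: qE; move: (q) => {}q wq sq qq0.
have qw : 0 < q - w by rewrite subr_gt0.
pose V' := w + w ^+ 2 / (q - w).
have vV' : v < V'.
  rewrite -ltrBDl ltr_pdivlMr // mulrC -ltr_pdivlMr //.
  by rewrite ltrBlDl.
pose v' := (v + Num.max 0 ((1 - q) / s - 1)) / 2.
have v'E : [/\ 0 < v', v' < v & 1 - q < s * (1 + v')].
  have h1 : 0 <= Num.max 0 ((1 - q) / s - 1) by rewrite le_max lexx.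
  have h2 : (1 - q) / s - 1 <= Num.max 0 ((1 - q) / s - 1) by rewrite le_max lexx orbT.
  have h4 : (1 - q) / s < 1 + v by rewrite ltr_pdivrMr // mulrC; lra.
  have h3 : Num.max 0 ((1 - q) / s - 1) < v by rewrite gt_max v0 /=; lra.
  rewrite /v'; split; [lra|lra|].
  by rewrite mulrC -ltr_pdivrMr //; lra.
case: v'E; move: (v') => {}v' v'0 v'v qv'.
apply: (parsed_of_asymp_unif b1 x01 xnz ww' _ xw' (xNv _ vV') _ _ v'0 (xv _ v'v) qv' s0).
- exact: lt_trans vV'.
- by rewrite /V'; field; rewrite gt_eqF.
- by apply: ltW; exact: lt_trans wq.
Qed.
End Point.

(** Points whose orbit reaches [0] are described by a single block. *)
Lemma hausdorff_dim_nonterminating (A : set R) (s : R) : 0 <= s ->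
  (forall x, A x -> 0 <= x <= 1) ->
  (forall x, A x -> (forall n, iter n T x != 0) -> forall s', s < s' ->
     forall M m0, exists m F, [/\ (m0 <= m)%N, F%:R <= s' * m%:R & parsed M x m F]) ->
  (hausdorff_dim A <= s%:E)%E.
Proof.
move=> s0 A01 Apar; apply: (hausdorff_dim_parsed b1 s0 A01) => x Ax s' ss' M m0.
have [xnz|/existsNP[n /negP/negPn/eqP xn0]] := pselect (forall n, iter n T x != 0).
  exact: Apar.
have s'0 : 0 < s' by exact: le_lt_trans ss'.
have [N HN] := nat_mul_ge n%:R s'0.
have T0 b : iter b T 0 = 0.
  by rewrite iter_beta_trans_run ?mulr0 ?ltr01.
exists (0 + n + (M + m0 + N))%N, (0 + n)%N; split; first nat_lia.
  by rewrite add0n; apply: HN; nat_lia.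
apply: parsed_block; [exact: parsed0|nat_lia|].
by rewrite iter_beta_transD add0n xn0 T0 mulr0.
Qed.

Lemma hausdorff_dim_asymp_le (A : set R) (v : R) : 0 <= v ->
  (forall x, A x -> 0 <= x <= 1) ->
  (forall x, A x -> (forall n, iter n T x != 0) -> asymp_rate_ge x v) ->
  (hausdorff_dim A <= (1 / (1 + v))%:E)%E.
Proof.
move=> v0 A01 Av; have v1 : 0 < 1 + v by lra.
apply: hausdorff_dim_nonterminating => // [|x Ax xnz s' ss'].
  by rewrite div1r invr_ge0 ltW.
apply: (parsed_of_asymp b1 (A01 _ Ax) v0 (Av _ Ax xnz)).
by rewrite -ltr_pdivrMr.
Qed.

Lemma hausdorff_dim_unif_le (A : set R) (w w' : R) : 0 < w < 1 -> w < w' ->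
  (forall x, A x -> 0 <= x <= 1) ->
  (forall x, A x -> (forall n, iter n T x != 0) -> unif_rate_ge x w') ->
  (hausdorff_dim A <= (((1 - w) / (1 + w)) ^+ 2)%:E)%E.
Proof.
move=> w01 ww' A01 Aw'; have /andP[w0 w1] := w01.
apply: hausdorff_dim_nonterminating => // [|x Ax xnz s' ss']; first exact: sqr_ge0.
have s'0 : 0 < s' by apply: le_lt_trans ss'; exact: sqr_ge0.
apply: (@parsed_of_unif x (A01 _ Ax) xnz w w') => //; first by rewrite w0.
  exact: Aw'.
by move=> v wv _; apply: le_lt_trans ss'; exact: joint_dim_le_unif.
Qed.

Lemma hausdorff_dim_joint_le (A : set R) (r w w' : R) : 0 < w < 1 -> w < w' ->
  2 * w / (1 - w) <= r ->
  (forall x, A x -> 0 <= x <= 1) ->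
  (forall x, A x -> (forall n, iter n T x != 0) -> unif_rate_ge x w' /\
     forall v, v < r -> asymp_rate_ge x v) ->
  (hausdorff_dim A <= (joint_dim r w)%:E)%E.
Proof.
move=> w01 ww' wr A01 Aw'; have /andP[w0 w1] := w01.
have w10 : 0 < 1 - w by rewrite subr_gt0.
have jd0 : 0 <= joint_dim r w.
  move: wr; rewrite ler_pdivrMr // => wr.
  have rw : 0 < r - w.
    by rewrite -(pmulr_lgt0 _ w10); have := mulr_gt0 w0 w0; lra.
  by apply: divr_ge0; [lra|apply: mulr_ge0; lra].
apply: hausdorff_dim_nonterminating => // x Ax xnz s' ss'.
have [xw' xr] := Aw' _ Ax xnz.
have s'0 : 0 < s' by exact: le_lt_trans ss'.
apply: (@parsed_of_unif x (A01 _ Ax) xnz w w') => //; first by rewrite w0.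
move=> v _ xv; apply: le_lt_trans ss'; apply: joint_dim_antitone => //.
rewrite leNgt; apply/negP => vr.
have vr2 : (v + r) / 2 < r by lra.
by have := xv _ (xr _ vr2); lra.
Qed.
End UpperBounds.

(** * Inserting zeros into an expansion *)

Section ZeroInsertion.
Context {R : realType}.
Variable beta : R.
Hypothesis b1 : 1 < beta.
Local Notation T := (beta_trans beta).

Let beta_gt0 : 0 < beta. Proof. exact: lt_trans b1. Qed.
Let betaX_gt0 n : 0 < beta ^+ n. Proof. exact: exprn_gt0. Qed.
Let betaX_neq0 n : beta ^+ n != 0. Proof. exact: lt0r_neq0. Qed.

Variable z : pred nat.

Fixpoint free_rank (n : nat) : nat :=
  if n is n'.+1 then free_rank n' + ~~ z n' else 0.

Lemma free_rank_le m n : (m <= n)%N -> (free_rank m <= free_rank n)%N.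
Proof.
elim: n => [|n IH]; first by rewrite leqn0 => /eqP ->.
rewrite leq_eqVlt => /predU1P[->//|mn].
by apply: leq_trans (IH mn) _; rewrite leq_addr.
Qed.

(** The digits of [y] are written at the positions outside [z], and zeros at the
positions in [z]; [inserted_tail y n] is the number whose digits are those from
position [n] on. *)
Definition inserted_digit (y : R) n : nat :=
  if z n then 0%N else digit beta (iter (free_rank n) T y).

Fixpoint inserted_sum (y : R) (N n : nat) : R :=
  if N is N'.+1 then ((inserted_digit y n)%:R + inserted_sum y N' n.+1) / beta else 0.

Definition inserted_tail (y : R) n : R := lim (inserted_sum y N n @[N --> \oo]).

Definition insert_zeros (y : R) : R := inserted_tail y 0.

Lemma inserted_sum_ge0 y N n : 0 <= inserted_sum y N n.
Proof.
elim: N n => //= N IH n; apply: divr_ge0; last exact: ltW.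
by apply: addr_ge0; [exact: ler0n|exact: IH].
Qed.

Lemma inserted_sumS y N n : inserted_sum y N n <= inserted_sum y N.+1 n.
Proof.
elim: N n => [|N IH] n; first exact: inserted_sum_ge0.
by rewrite /= ler_pM2r ?invr_gt0 // lerD2l; exact: IH.
Qed.

(** Inserting zeros never increases a tail.  All the tails are thus less than
[1], which makes the new sequence admissible for every [beta]. *)
Lemma inserted_sum_le y N n : 0 <= y -> inserted_sum y N n <= iter (free_rank n) T y.
Proof.
move=> y0; elim: N n => [|N IH] n /=; first exact: iter_beta_trans_ge0.
have t0 := iter_beta_trans_ge0 beta (free_rank n) y0.
rewrite ler_pdivrMr // mulrC /inserted_digit; have := IH n.+1 => /=.
case: (z n) => /= IHn.
  rewrite add0r; apply: le_trans IHn _; rewrite addn0.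
  by rewrite ler_peMl // ltW.
rewrite (mul_beta_digit b1 t0) lerD2l; apply: le_trans IHn _.
by rewrite addn1 iterS.
Qed.

Lemma cvg_inserted_sum y n : 0 <= y ->
  inserted_sum y N n @[N --> \oo] --> inserted_tail y n.
Proof.
move=> y0; apply: nondecreasing_is_cvgn.
  by apply/nondecreasing_seqP => N; exact: inserted_sumS.
exists (iter (free_rank n) T y) => _ [N _ <-]; exact: inserted_sum_le.
Qed.

Lemma mul_beta_inserted_tail y n : 0 <= y ->
  beta * inserted_tail y n = (inserted_digit y n)%:R + inserted_tail y n.+1.
Proof.
move=> y0; have h1 : inserted_sum y N.+1 n @[N --> \oo] --> inserted_tail y n.
  by have := @cvg_inserted_sum y n y0; rewrite -(cvg_shiftS (fun N => inserted_sum y N n)).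
have h2 : beta * inserted_sum y N.+1 n @[N --> \oo] --> beta * inserted_tail y n.
  by apply: cvgM => //; exact: cvg_cst.
have h3 : (inserted_digit y n)%:R + inserted_sum y N n.+1 @[N --> \oo] -->
    (inserted_digit y n)%:R + inserted_tail y n.+1.
  by apply: cvgD; [exact: cvg_cst|exact: cvg_inserted_sum].
have hE : (fun N => beta * inserted_sum y N.+1 n) =
    (fun N => (inserted_digit y n)%:R + inserted_sum y N n.+1).
  by apply/funext => N /=; rewrite mulrC divfK // gt_eqF.
by rewrite hE in h2; exact: (cvg_unique (@norm_hausdorff _ R) h2 h3).
Qed.

Lemma inserted_tail_ge0 y n : 0 <= y -> 0 <= inserted_tail y n.
Proof.
move=> y0; rewrite /inserted_tail; apply: limr_ge; first exact: cvg_inserted_sum.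
by apply: nearW => N; exact: inserted_sum_ge0.
Qed.

Lemma inserted_tail_le y n : 0 <= y -> inserted_tail y n <= iter (free_rank n) T y.
Proof.
move=> y0; rewrite /inserted_tail; apply: limr_le; first exact: cvg_inserted_sum.
by apply: nearW => N; exact: inserted_sum_le.
Qed.

Section Orbit.
Variable y : R.
Hypothesis y01 : 0 <= y < 1.
Let y0 : 0 <= y. Proof. by case/andP: y01. Qed.

Lemma iter_lt1 n : iter n T y < 1.
Proof.
case: n => [|n]; first by case/andP: y01.
by have /andP[] := beta_trans_itv beta (iter n T y).
Qed.

Lemma inserted_tail_lt1 n : inserted_tail y n < 1.
Proof. exact: le_lt_trans (inserted_tail_le n y0) (iter_lt1 _). Qed.

(** A sequence of digits with all tails in [0, 1) is a beta-expansion. *)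
Lemma iter_insert_zeros n : iter n T (insert_zeros y) = inserted_tail y n.
Proof.
elim: n => // n IH; rewrite iterS IH.
apply: beta_trans_def (mul_beta_inserted_tail n y0) _.
by rewrite inserted_tail_ge0 // inserted_tail_lt1.
Qed.

Lemma insert_zeros_itv : 0 <= insert_zeros y <= 1.
Proof. by rewrite inserted_tail_ge0 // ltW // inserted_tail_lt1. Qed.

Lemma inserted_run_small n b : (forall j, (n <= j < n + b)%N -> z j) ->
  iter n T (insert_zeros y) < beta ^- b.
Proof.
move=> zn; rewrite iter_insert_zeros.
suff : beta ^+ b * inserted_tail y n = inserted_tail y (n + b).
  by move=> h; rewrite -[ltRHS]mul1r ltr_pdivlMr // mulrC h inserted_tail_lt1.
elim: b n zn => [|b IH] n zn; first by rewrite mul1r addn0.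
rewrite addnS -addSn -IH; last by move=> j jb; apply: zn; nat_lia.
have zn0 : z n by apply: zn; nat_lia.
by rewrite exprSr -mulrA mul_beta_inserted_tail // /inserted_digit zn0 add0r.
Qed.
End Orbit.

Section Hoelder.
Variables (s c : R).
Hypothesis s0 : 0 < s.
Hypothesis s1 : s <= 1.
Hypothesis rank_ge : forall n, s * n%:R <= (free_rank n)%:R + c.

Let C := beta * beta `^ c.

Lemma rank_power n : beta ^- free_rank n <= beta `^ c * (beta ^- n) `^ s.
Proof.
rewrite -!powR_invn ?(ltW beta_gt0) // -powRrM -powRD; last by rewrite (gt_eqF beta_gt0) implybT.
by apply: powb_le => //; have := rank_ge n; lra.
Qed.

Lemma free_rank_unbounded k : exists n, (k <= free_rank n)%N.
Proof.
have [N HN] := nat_mul_ge (k%:R + c) s0.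
exists N; rewrite -(ler_nat R); have := rank_ge N; have := HN N (leqnn _); lra.
Qed.

(** Zero digits change neither of these two quantities, whether they are inserted
or belong to [y]. *)
Lemma inserted_prefix0 y n k : 0 <= y ->
  (forall j, (n <= j < n + k)%N -> inserted_digit y j = 0%N) ->
  beta ^- free_rank (n + k) * iter (free_rank (n + k)) T y =
    beta ^- free_rank n * iter (free_rank n) T y /\
  beta ^- (n + k) * inserted_tail y (n + k) = beta ^- n * inserted_tail y n.
Proof.
move=> y0; elim: k => [|k IH] dn; first by rewrite addn0.
have [<- <-] := IH ltac:(move=> j jk; apply: dn; nat_lia).
have d0 : inserted_digit y (n + k) = 0%N by apply: dn; nat_lia.
split; last first.
  have := mul_beta_inserted_tail (n + k) y0; rewrite d0 add0r addnS => <-.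
  by rewrite exprS; field; rewrite betaX_neq0 gt_eqF.
rewrite addnS /=; move: d0; rewrite /inserted_digit; case: (z (n + k)) => /= d0.
  by rewrite addn0.
have t0 := iter_beta_trans_ge0 beta (free_rank (n + k)) y0.
have := mul_beta_digit b1 t0; rewrite d0 add0r addn1 iterS => <-.
by rewrite exprS; field; rewrite betaX_neq0 gt_eqF.
Qed.

(** Both sides are governed by the position [i] of the first nonzero digit after
[n]: the left one is at most [beta ^- free_rank i] and the right one comes from
a number at least [beta ^- i.+1]. *)
Lemma inserted_tail_holder y n : 0 <= y < 1 ->
  beta ^- free_rank n * iter (free_rank n) T y <= C * (beta ^- n * inserted_tail y n) `^ s.
Proof.
move=> y01; have /andP[y0 _] := y01.
have C0 : 0 <= C by rewrite mulr_ge0 ?powR_ge0 // ltW.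
have [[k dk]|nok] := pselect (exists k, inserted_digit y (n + k) != 0%N); last first.
  suff -> : iter (free_rank n) T y = 0 by rewrite mulr0 mulr_ge0 ?powR_ge0.
  have all0 j : inserted_digit y (n + j) = 0%N.
    by apply/eqP; apply: contrapT => h; apply: nok; exists j; apply/negP.
  have t0 := iter_beta_trans_ge0 beta (free_rank n) y0.
  apply/eqP; rewrite eq_le t0 andbT leNgt; apply/negP => tn0.
  have [N HN] := near_powb_le b1 ltr01 (mulr_gt0 (divr_gt0 ltr01 (betaX_gt0 (free_rank n))) tn0).
  have [m Nm] := free_rank_unbounded N.
  have Nm' : (N <= free_rank (n + m))%N by apply: leq_trans Nm (free_rank_le _); exact: leq_addl.
  have [h _] : beta ^- free_rank (n + m) * iter (free_rank (n + m)) T y =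
      beta ^- free_rank n * iter (free_rank n) T y /\
    beta ^- (n + m) * inserted_tail y (n + m) = beta ^- n * inserted_tail y n.
    by apply: inserted_prefix0 => // j /andP[nj _]; rewrite -(subnKC nj).
  have := HN _ Nm'; rewrite div1r -h mul1r powR_invn ?(ltW beta_gt0) // leNgt.
  by rewrite gtr_pMr ?invr_gt0 // iter_lt1.
have [k' dk' k'min] := ex_minnP (ex_intro (fun k => inserted_digit y (n + k) != 0%N) k dk).
have [j jk'|<- <-] := @inserted_prefix0 y n k' y0.
  have /andP[nj jnk'] := jk'; apply/eqP; apply: contraT => dj.
  have := k'min (j - n)%N; rewrite subnKC // => /(_ dj) k'j.
  by exfalso; nat_lia.
move: dk'; set i := (n + k')%N => di.
have free_i : z i = false by move: di; rewrite /inserted_digit; case: (z i).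
apply: le_trans (_ : beta ^- free_rank i <= _).
  by rewrite ler_piMr ?invr_ge0 ?(ltW (betaX_gt0 _)) // ltW // iter_lt1.
have -> : beta ^- free_rank i = beta * beta ^- free_rank i.+1.
  by rewrite /= free_i addn1 exprS; field; rewrite betaX_neq0 gt_eqF.
rewrite /C -mulrA ler_pM2l //; apply: le_trans (rank_power _) _.
rewrite ler_pM2l ?powR_gt0 //; apply: ge0_ler_powR; rewrite ?nnegrE ?(ltW s0) //.
- by rewrite invr_ge0 ltW.
- by rewrite mulr_ge0 ?inserted_tail_ge0 // invr_ge0 ltW.
- have -> : beta ^- i.+1 = beta ^- i * beta^-1 by rewrite exprS invfM mulrC.
  rewrite ler_pM2l ?invr_gt0 // -[leLHS]mul1r ler_pdivrMr // mulrC.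
  rewrite mul_beta_inserted_tail //; apply: le_trans (_ : (inserted_digit y i)%:R <= _).
    by rewrite ler1n lt0n.
  by rewrite lerDl inserted_tail_ge0.
Qed.

Lemma common_digits y y' n : 0 <= y -> 0 <= y' ->
  (forall j, (j < n)%N -> digit beta (iter j T y) = digit beta (iter j T y')) ->
  iter n T y' - iter n T y = beta ^+ n * (y' - y).
Proof.
move=> y0 y'0; elim: n => [|n IH] dn; first by rewrite mul1r.
have t0 := iter_beta_trans_ge0 beta n y0; have t'0 := iter_beta_trans_ge0 beta n y'0.
have := mul_beta_digit b1 t0; have := mul_beta_digit b1 t'0; rewrite dn // -!iterS.
have := IH (fun j jn => dn j (ltnW jn)); rewrite exprS -mulrA => <- e1 e2.
by rewrite mulrBr e1 e2; ring.
Qed.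

Lemma common_inserted_digits y y' n : 0 <= y -> 0 <= y' ->
  (forall j, (j < free_rank n)%N -> digit beta (iter j T y) = digit beta (iter j T y')) ->
  inserted_tail y' n - inserted_tail y n = beta ^+ n * (insert_zeros y' - insert_zeros y).
Proof.
move=> y0 y'0; elim: n => [|n IH] dn; first by rewrite mul1r.
have := mul_beta_inserted_tail n y0; have := mul_beta_inserted_tail n y'0.
have -> : inserted_digit y' n = inserted_digit y n.
  rewrite /inserted_digit; case: ifPn => // zn; rewrite dn //=.
  by rewrite zn addn1.
have := IH (fun j jn => dn j (leq_trans jn (leq_addr _ _))).
rewrite exprS -mulrA => <- e1 e2.
by rewrite mulrBr e1 e2; ring.
Qed.

(** Let the digits of [y] and [y'] first differ at the position [J], which moves
to [i].  The distance [y' - y] splits at the left endpoint [p] of the cylinder of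
[y'] of order [J + 1].  The part from [p] to [y'] is [inserted_tail_holder].  On
the other side, inserting zeros moves the tail of [y] away from [1], so [u <= U],
and the power [s <= 1] of a bounded number is at least a multiple of it. *)
Lemma insert_zeros_holder_lt y y' : 0 <= y < 1 -> 0 <= y' < 1 -> y < y' ->
  `|y' - y| <= 2 * C * `|insert_zeros y' - insert_zeros y| `^ s.
Proof.
move=> y01 y'01 yy'; have /andP[y0 y1] := y01; have /andP[y'0 y'1] := y'01.
have C0 : 0 < C by rewrite mulr_gt0 ?powR_gt0.
have [J0 dJ0] : exists j, digit beta (iter j T y) != digit beta (iter j T y').
  apply: contrapT => same.
  have y'y : 0 < y' - y by rewrite subr_gt0.
  have [N HN] := near_powb_le b1 ltr01 y'y.
  have h : 1 <= beta ^+ N * (y' - y).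
    by rewrite -ler_pdivrMl // mulr1 -powR_invn ?(ltW beta_gt0) // -[N%:R]mul1r HN.
  have eqd j : (j < N)%N -> digit beta (iter j T y) = digit beta (iter j T y').
    by move=> _; apply/eqP; apply: contrapT => hj; apply: same; exists j; apply/negP.
  have := common_digits y0 y'0 eqd.
  have := iter_lt1 y'01 N; have := iter_beta_trans_ge0 beta N y0; lra.
have [J dJ Jmin] := ex_minnP (ex_intro (fun j => _ != _) J0 dJ0).
have same j : (j < J)%N -> digit beta (iter j T y) = digit beta (iter j T y').
  by move=> jJ; apply/eqP; apply: contraLR jJ => dj; rewrite -leqNgt; exact: Jmin.
have [n1 Jn1] := free_rank_unbounded J.+1.
have [i' Ji' i'min] := ex_minnP (ex_intro (fun n => (J < free_rank n)%N) n1 Jn1).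
have [i [rankS ranki free_i]] : exists i, [/\ free_rank i.+1 = J.+1, free_rank i = J & z i = false].
  case: i' Ji' i'min => // i Ji imin; exists i.
  have : (free_rank i <= J)%N by rewrite leqNgt; apply/negP => /imin; rewrite ltnn.
  by move: Ji => /=; case: (z i) => /=; split => //; nat_lia.
set x := insert_zeros y; set x' := insert_zeros y'.
have tJ0 := iter_beta_trans_ge0 beta J y0; have tJ'0 := iter_beta_trans_ge0 beta J y'0.
pose a : R := (digit beta (iter J T y'))%:R - (digit beta (iter J T y))%:R.
have yE : beta ^+ J.+1 * (y' - y) = a - iter J.+1 T y + iter J.+1 T y'.
  rewrite exprS -mulrA -common_digits // mulrBr (mul_beta_digit b1 tJ0).
  by rewrite (mul_beta_digit b1 tJ'0) /a !iterS; ring.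
have xE : beta ^+ i.+1 * (x' - x) = a - inserted_tail y i.+1 + inserted_tail y' i.+1.
  rewrite exprS -mulrA -common_inserted_digits //; last by rewrite ranki.
  rewrite mulrBr !mul_beta_inserted_tail // /inserted_digit free_i ranki /a; ring.
have a1 : 1 <= a.
  have : 0 < beta ^+ J.+1 * (y' - y) by rewrite mulr_gt0 // subr_gt0.
  rewrite yE => apos; have := iter_lt1 y'01 J.+1 => h1.
  have h2 := iter_beta_trans_ge0 beta J.+1 y0.
  have lt_d : (digit beta (iter J T y) < (digit beta (iter J T y')).+1)%N.
    by rewrite -(ltr_nat R) -natr1; move: apos; rewrite /a; lra.
  have ltd : (digit beta (iter J T y) < digit beta (iter J T y'))%N.
    by rewrite ltn_neqAle dJ -ltnS.
  by move: ltd; rewrite -(ler_nat R) -natr1 /a; lra.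
have abeta : a <= beta.
  have := mul_beta_digit b1 tJ'0; have := iter_lt1 y'01 J; have := iter_beta_trans_ge0 beta J.+1 y'0.
  rewrite iterS => h1 h2 h3.
  have : beta * iter J T y' <= beta by rewrite ler_piMr // ltW.
  by rewrite h3 /a; have := ler0n R (digit beta (iter J T y)); lra.
pose u := a - iter J.+1 T y; pose U := a - inserted_tail y i.+1.
have u0 : 0 < u by have := iter_lt1 y01 J.+1; rewrite /u; lra.
have uU : u <= U.
  by have := inserted_tail_le i.+1 y0; rewrite rankS /u /U; lra.
have ubeta : u <= beta.
  by have := iter_beta_trans_ge0 beta J.+1 y0; rewrite /u; lra.
have t'0 := inserted_tail_ge0 i.+1 y'0.
have xxE : x' - x = beta ^- i.+1 * U + beta ^- i.+1 * inserted_tail y' i.+1.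
  by rewrite -mulrDr -xE mulKf.
have yyE : y' - y = beta ^- J.+1 * u + beta ^- J.+1 * iter J.+1 T y'.
  by rewrite -mulrDr -yE mulKf.
have V0 : 0 < beta ^- i.+1 by rewrite invr_gt0.
have xx0 : 0 <= x' - x.
  by rewrite xxE addr_ge0 // mulr_ge0 ?(ltW V0) // (le_trans (ltW u0)).
have part1 : beta ^- J.+1 * u <= C * (x' - x) `^ s.
  apply: le_trans (_ : C * (beta ^- i.+1 * u) `^ s <= _); last first.
    rewrite ler_pM2l //; apply: ge0_ler_powR; rewrite ?nnegrE ?(ltW s0) //.
      by rewrite mulr_ge0 ?(ltW V0) // ltW.
    rewrite xxE; apply: ler_wpDr; first by rewrite mulr_ge0 // ltW.
    by rewrite ler_pM2l.
  rewrite powRM ?(ltW V0) ?(ltW u0) // -rankS.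
  have us : u / beta <= u `^ s.
    apply: le_trans (_ : (u / beta) `^ s <= _).
      by apply: ger1_powR => //; rewrite divr_gt0 //= ler_pdivrMr // mul1r.
    apply: ge0_ler_powR; rewrite ?nnegrE ?(ltW s0) ?(ltW u0) //.
      by rewrite divr_ge0 // ltW.
    by rewrite ler_piMr ?(ltW u0) // invf_le1 // ltW.
  apply: le_trans (_ : beta `^ c * (beta ^- i.+1) `^ s * u <= _).
    by rewrite ler_pM2r //; exact: rank_power.
  have -> : C * ((beta ^- i.+1) `^ s * u `^ s) =
      beta `^ c * (beta ^- i.+1) `^ s * (beta * u `^ s) by rewrite /C; ring.
  by rewrite ler_pM2l ?mulr_gt0 ?powR_gt0 // -ler_pdivrMl // mulrC.
have part2 : beta ^- J.+1 * iter J.+1 T y' <= C * (x' - x) `^ s.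
  rewrite -rankS; apply: le_trans (inserted_tail_holder i.+1 y'01) _.
  rewrite ler_pM2l //; apply: ge0_ler_powR; rewrite ?nnegrE ?(ltW s0) //.
    by rewrite mulr_ge0 // ltW.
  by rewrite xxE lerDr mulr_ge0 ?(ltW V0) // (le_trans (ltW u0)).
rewrite !ger0_norm ?subr_ge0 ?(ltW yy') //; last by rewrite -subr_ge0.
by rewrite yyE; lra.
Qed.

Lemma insert_zeros_holder y y' : 0 <= y < 1 -> 0 <= y' < 1 ->
  `|y - y'| <= 2 * C * `|insert_zeros y - insert_zeros y'| `^ s.
Proof.
move=> y01 y'01; have [yy'|y'y|->] := ltgtP y y'.
- by rewrite distrC [X in X `^ s]distrC; exact: insert_zeros_holder_lt.
- exact: insert_zeros_holder_lt.
- by rewrite !subrr normr0 mulr_ge0 ?powR_ge0 // !mulr_ge0 ?powR_ge0 // ltW.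
Qed.

Lemma hausdorff_dim_insert_zeros_ge (A : set R) :
  (forall y, 0 <= y < 1 -> A (insert_zeros y)) -> (s%:E <= hausdorff_dim A)%E.
Proof.
move=> Ains; apply: (@hausdorff_dim_ge_holder _ A insert_zeros (2 * C)) => //.
  by rewrite !mulr_gt0 ?powR_gt0.
exact: insert_zeros_holder.
Qed.
End Hoelder.
End ZeroInsertion.

(** * Lower bounds for the dimension *)

Section BlockPositions.
Context {R : realType}.

Lemma free_rank_free (z : pred nat) m d :
  (forall j, (m <= j < m + d)%N -> ~~ z j) -> free_rank z (m + d) = (free_rank z m + d)%N.
Proof.
elim: d => [|d IH] zm; first by rewrite !addn0.
rewrite !addnS /= IH; last by move=> j jd; apply: zm; nat_lia.
by rewrite (zm (m + d)%N) ?addn1 //; nat_lia.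
Qed.

Variables (a b : nat -> nat).
Hypothesis b_gt0 : forall k, (0 < b k)%N.
Hypothesis ab : forall k, (a k + b k <= a k.+1)%N.

Definition in_block (n : nat) : bool := `[< exists k, (a k <= n < a k + b k)%N >].

Lemma block_mono j k : (j < k)%N -> (a j + b j <= a k)%N.
Proof.
elim: k => // k IH; rewrite ltnS leq_eqVlt => /predU1P[->|jk]; first exact: ab.
by apply: leq_trans (IH jk) (leq_trans (leq_addr _ _) (ab k)).
Qed.

Lemma block_start_ge k : (k <= a k)%N.
Proof.
elim: k => // k IH; have := ab k; have := b_gt0 k; nat_lia.
Qed.

Lemma block_locate N : (a 0 <= N)%N -> exists k, (a k <= N < a k.+1)%N.
Proof.
move=> a0N; have exk : exists k, (N < a k.+1)%N by exists N; exact: block_start_ge.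
have [k Nk kmin] := ex_minnP exk; exists k; rewrite Nk andbT.
case: k Nk kmin => // k Nk kmin; rewrite leqNgt; apply/negP => /kmin.
by rewrite ltnn.
Qed.

Lemma in_blockP n k : (a k <= n < a k + b k)%N -> in_block n.
Proof. by move=> kn; apply/asboolP; exists k. Qed.

Lemma not_in_block n k : (a k + b k <= n < a k.+1)%N -> ~~ in_block n.
Proof.
move=> kn; apply/asboolP => -[j jn].
have [jk|kj|jk] := ltngtP j k; last by subst j; nat_lia.
  by have := block_mono jk; nat_lia.
have : (a k.+1 <= a j)%N.
  have [->//|kj'] := eqVneq j k.+1.
  have kj2 : (k.+1 < j)%N by rewrite ltn_neqAle eq_sym kj' kj.
  by have := block_mono kj2; nat_lia.
by nat_lia.
Qed.

Lemma not_in_block0 n : (n < a 0)%N -> ~~ in_block n.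
Proof.
move=> n0; apply/asboolP => -[j jn].
case: j jn => [|j] jn; first by nat_lia.
by have := @block_mono 0 j.+1 isT; nat_lia.
Qed.

(** By the last hypothesis, the proportion of zeros is at most [q] at the
beginning of every block.  It is largest at the end of a block, where the bound
on [s] comes from. *)
Lemma in_block_rank (v q s : R) : 0 <= q -> 0 <= s <= 1 -> s * (1 + v) <= 1 - q ->
  (forall k, (b k)%:R <= v * (a k)%:R + 1) ->
  (forall k, q * (a k)%:R + (b k)%:R <= q * (a k.+1)%:R) ->
  forall n, s * n%:R <= (free_rank in_block n)%:R + 1.
Proof.
move=> q0 /andP[s0 s1] sv bv qa.
have rank_a0 n : (n <= a 0)%N -> free_rank in_block n = n.
  move=> na0; rewrite -[in LHS](add0n n) free_rank_free ?add0n // => j jn.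
  by apply: not_in_block0; nat_lia.
have rank_gap k n : (a k + b k <= n <= a k.+1)%N ->
    free_rank in_block n = (free_rank in_block (a k + b k) + (n - (a k + b k)))%N.
  move=> kn; have kn1 : (a k + b k <= n)%N by nat_lia.
  rewrite -[in LHS](subnKC kn1) free_rank_free // => j jn.
  by apply: (@not_in_block j k); nat_lia.
have rank_a k : (1 - q) * (a k)%:R <= (free_rank in_block (a k))%:R.
  elim: k => [|k IH].
    by rewrite rank_a0 // ler_piMl // lerBlDr lerDl.
  rewrite (rank_gap k) ?ab ?leqnn // natrD natrB ?ab // natrD.
  have : (free_rank in_block (a k))%:R <= (free_rank in_block (a k + b k))%:R :> R.
    by rewrite ler_nat free_rank_le // leq_addr.
  by have := qa k; lra.
have rank_end k : s * (a k + b k)%:R <= (free_rank in_block (a k))%:R + 1.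
  apply: le_trans (_ : s * ((1 + v) * (a k)%:R + 1) <= _).
    by rewrite ler_wpM2l // natrD; have := bv k; lra.
  have : s * (1 + v) * (a k)%:R <= (1 - q) * (a k)%:R by rewrite ler_wpM2r.
  by have := rank_a k; lra.
move=> n; have [na0|a0n] := leqP n (a 0).
  by rewrite rank_a0 //; apply: ler_wpDr => //; rewrite ler_piMl.
have [k kn] := block_locate (ltnW a0n).
have [nk|kn2] := leqP n (a k + b k).
  apply: le_trans (_ : s * (a k + b k)%:R <= _); first by rewrite ler_wpM2l // ler_nat.
  apply: le_trans (rank_end k) _; rewrite lerD2r ler_nat free_rank_le //; nat_lia.
rewrite (rank_gap k); last by nat_lia.
rewrite natrD natrB; last exact: ltnW.
have := rank_end k.
have : (free_rank in_block (a k))%:R <= (free_rank in_block (a k + b k))%:R :> R.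
  by rewrite ler_nat free_rank_le // leq_addr.
have : s * (n%:R - (a k + b k)%:R) <= n%:R - (a k + b k)%:R.
  by rewrite ler_piMl // subr_ge0 ler_nat ltnW.
lra.
Qed.
End BlockPositions.

Section LowerBound.
Context {R : realType}.
Variable beta : R.
Hypothesis b1 : 1 < beta.
Local Notation T := (beta_trans beta).

Let beta_gt0 : 0 < beta. Proof. exact: lt_trans b1. Qed.

(** Block [k] starts at [n_k] and has length about [v * n_k], which is also
[w * n_(k + 1)]: the first expression gives the asymptotic exponent [v], the
second one the uniform exponent [w]. *)
Fixpoint block_starts (v w : R) (n0 k : nat) : nat :=
  if k is k'.+1 then Num.truncn (v * (block_starts v w n0 k')%:R / w) else n0.

Definition block_length (v : R) (n : nat) : nat := (Num.truncn (v * n%:R)).+1.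

(** The condition on [v] and [w] says that there is room for free digits between
two consecutive blocks.  The blocks take up a proportion [v * w / (v - w)] of
the digits before a block, and [s < joint_dim v w] leaves room for a slightly
larger proportion [q], which absorbs the integer parts. *)
Lemma hausdorff_dim_joint_ge (A : set R) (v w : R) : 0 < v -> 0 < w -> w * (1 + v) < v ->
  (forall x, 0 <= x <= 1 -> asymp_rate_ge beta x v -> unif_rate_ge beta x w -> A x) ->
  ((joint_dim v w)%:E <= hausdorff_dim A)%E.
Proof.
move=> v0 w0 wv AP.
have vw : 0 < v - w by have := mulr_gt0 w0 v0; lra.
have v1 : 0 < 1 + v by lra.
have q_gt0 : 0 < v * w / (v - w) by rewrite divr_gt0 ?mulr_gt0.
have jdE : joint_dim v w * (1 + v) = 1 - v * w / (v - w).
  by rewrite /joint_dim; field; rewrite !gt_eqF.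
have jd1 : joint_dim v w < 1.
  by rewrite -(ltr_pM2r v1) jdE; lra.
suff dimA s : 0 < s -> s < joint_dim v w -> (s%:E <= hausdorff_dim A)%E.
  apply/lee_addgt0Pr => e e0.
  have [se|se] := leP (joint_dim v w - e) 0.
    apply: le_trans (_ : e%:E <= _)%E; first by rewrite lee_fin; lra.
    by rewrite leeDr // hausdorff_dim_ge0.
  rewrite -leeBlDr // -EFinB; apply: dimA => //; lra.
move=> s0 sjd; pose q := 1 - s * (1 + v).
have qq : v * w / (v - w) < q.
  have : s * (1 + v) < joint_dim v w * (1 + v) by rewrite ltr_pM2r.
  by rewrite jdE /q; lra.
have q0 : 0 < q by exact: lt_trans qq.
have c1 : 0 < v / w - 1 - v.
  rewrite -(pmulr_lgt0 _ w0) !mulrBl divfK ?gt_eqF //; lra.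
have c2 : 0 < q * (v / w - 1) - v.
  move: qq; rewrite ltr_pdivrMr // => qq.
  rewrite -(pmulr_lgt0 _ w0).
  have -> : (q * (v / w - 1) - v) * w = q * (v - w) - v * w by field; rewrite gt_eqF.
  by rewrite subr_gt0.
have [N1 HN1] := nat_mul_ge 2 c1.
have [N2 HN2] := nat_mul_ge (1 + q) c2.
pose a := block_starts v w (N1 + N2); pose b k := block_length v (a k).
have trunc_bounds (y : R) : 0 <= y -> (Num.truncn y)%:R <= y < (Num.truncn y)%:R + 1.
  by move=> y0; rewrite natr1 truncn_itv.
have vX (n : nat) : 0 <= v * n%:R by rewrite mulr_ge0 // ltW.
have vwX (n : nat) : 0 <= v * n%:R / w by rewrite divr_ge0 // ltW.
have b_bounds k : v * (a k)%:R < (b k)%:R <= v * (a k)%:R + 1.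
  have /andP[h1 h2] := trunc_bounds _ (vX (a k)).
  by rewrite /b /block_length -natr1; apply/andP; split; lra.
have a_bounds k : (a k.+1)%:R <= v * (a k)%:R / w < (a k.+1)%:R + 1.
  exact: trunc_bounds.
have ab_of k : (N1 <= a k)%N -> (a k + b k <= a k.+1)%N.
  move=> N1k; rewrite -ltnS -(ltr_nat R) -natr1 natrD.
  have := HN1 _ N1k; have /andP[_] := a_bounds k; have /andP[_] := b_bounds k.
  have -> : v * (a k)%:R / w = v / w * (a k)%:R by rewrite mulrAC.
  lra.
have a_ge k : (N1 + N2 <= a k)%N.
  elim: k => // k IH; have := ab_of k ltac:(exact: leq_trans (leq_addr _ _) IH).
  by apply: leq_trans; apply: leq_trans IH (leq_addr _ _).
have ab k : (a k + b k <= a k.+1)%N.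
  by apply: ab_of; exact: leq_trans (leq_addr _ _) (a_ge k).
have qa k : q * (a k)%:R + (b k)%:R <= q * (a k.+1)%:R.
  have N2k : (N2 <= a k)%N by exact: leq_trans (leq_addl _ _) (a_ge k).
  have := HN2 _ N2k; have /andP[_ h] := a_bounds k; have /andP[_] := b_bounds k.
  have : q * (v * (a k)%:R / w) <= q * ((a k.+1)%:R + 1) by rewrite ler_pM2l // ltW.
  have -> : v * (a k)%:R / w = v / w * (a k)%:R by rewrite mulrAC.
  lra.
have b0 k : (0 < b k)%N by [].
apply: (@hausdorff_dim_insert_zeros_ge _ beta b1 (in_block a b) s 1) => //.
- by apply: ltW; exact: lt_trans jd1.
- apply: (@in_block_rank R a b b0 ab v q s) => //.
  + exact: ltW.
  + by rewrite ltW //= ltW // (lt_trans sjd).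
  + by rewrite /q; lra.
  + by move=> k; have /andP[] := b_bounds k.
move=> y y01; set x := insert_zeros _ _ _.
have x_small k u : u <= (b k)%:R -> iter (a k) T x < beta `^ (- u).
  move=> ub; apply: lt_le_trans (_ : beta ^- b k <= _).
    by apply: inserted_run_small => // j; exact: in_blockP.
  by rewrite -powR_invn ?(ltW beta_gt0) //; apply: powb_le => //; rewrite lerN2.
apply: AP.
- exact: insert_zeros_itv.
- move=> n0; exists (a n0); first exact: (block_start_ge b0 ab).
  by apply: x_small; have /andP[/ltW] := b_bounds n0.
- exists (a 0) => N a0N; have [k /andP[akN Nak]] := block_locate b0 ab a0N.
  exists (a k) => //; apply: x_small.
  have /andP[+ _] := a_bounds k; rewrite ler_pdivlMr // => h.
  apply: le_trans (_ : w * (a k.+1)%:R <= _); first by rewrite ler_pM2l // ler_nat ltnW.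
  by have /andP[] := b_bounds k; lra.
Qed.
End LowerBound.

(** * Limits of the bounds *)

Section Limits.
Context {R : realType}.
Implicit Types (f g h : R -> R) (D : \bar R).

(** Continuity at [0] in a form on which the structure of a rational expression
can be read. *)
Definition continuous0 h := h e @[e --> 0] --> h 0.

Lemma continuous0_cst (a : R) : continuous0 (fun=> a).
Proof. exact: cvg_cst. Qed.

Lemma continuous0_id : continuous0 (fun e => e).
Proof. exact: cvg_id. Qed.

Lemma continuous0D f g : continuous0 f -> continuous0 g -> continuous0 (fun e => f e + g e).
Proof. exact: cvgD. Qed.

Lemma continuous0N f : continuous0 f -> continuous0 (fun e => - f e).
Proof. exact: cvgN. Qed.

Lemma continuous0M f g : continuous0 f -> continuous0 g -> continuous0 (fun e => f e * g e).
Proof. exact: cvgM. Qed.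

Lemma continuous0V f : f 0 != 0 -> continuous0 f -> continuous0 (fun e => (f e)^-1).
Proof. exact: cvgV. Qed.

Lemma continuous0_sqr f : continuous0 f -> continuous0 (fun e => f e ^+ 2).
Proof. by move=> fc; under [X in continuous0 X]eq_fun do rewrite expr2; exact: continuous0M. Qed.

Lemma ge_limit_at0 h D : continuous0 h ->
  (exists2 e0 : R, 0 < e0 & forall e, 0 < e < e0 -> (D <= (h e)%:E)%E) ->
  (D <= (h 0)%:E)%E.
Proof.
move=> /cvgrPdist_le hc [e0 e00 hD]; apply/lee_addgt0Pr => eps eps0.
have := hc eps eps0; rewrite near_simpl => /nbhs_ballP[d /= d0 hd].
pose e := Num.min d e0 / 2.
have m0 : 0 < Num.min d e0 by rewrite lt_min d0.
have [md me] : Num.min d e0 <= d /\ Num.min d e0 <= e0 by rewrite !ge_min !lexx orbT.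
have ee : 0 < e < e0 by rewrite /e; apply/andP; split; lra.
apply: le_trans (hD e ee) _; rewrite -EFinD lee_fin.
have : ball 0 d e by rewrite /ball /= sub0r normrN gtr0_norm /e; lra.
by move=> /hd; rewrite /= ler_norml; lra.
Qed.

Lemma le_limit_at0 h D : continuous0 h ->
  (exists2 e0 : R, 0 < e0 & forall e, 0 < e < e0 -> ((h e)%:E <= D)%E) ->
  ((h 0)%:E <= D)%E.
Proof.
move=> hc [e0 e00 hD].
rewrite -leeN2 -EFinN; apply: (@ge_limit_at0 (fun e => - h e)); first exact: continuous0N.
by exists e0 => // e ee; rewrite EFinN leeN2 hD.
Qed.
End Limits.

Ltac rational_continuity :=
  repeat lazymatch goal with
  | |- continuous0 (fun=> ?a) => exact: continuous0_cst
  | |- continuous0 (fun e => e) => exact: continuous0_id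
  | |- continuous0 (fun e => GRing.add (@?f e) (@?g e)) => apply: (@continuous0D _ f g)
  | |- continuous0 (fun e => GRing.opp (@?f e)) => apply: (@continuous0N _ f)
  | |- continuous0 (fun e => GRing.mul (@?f e) (@?g e)) => apply: (@continuous0M _ f g)
  | |- continuous0 (fun e => GRing.inv (@?f e)) => apply: (@continuous0V _ f)
  | |- continuous0 (fun e => GRing.exp (@?f e) 2) => apply: (@continuous0_sqr _ f)
  end.

(** * The two exponents of a positive function *)

Section Rates.
Context {R : realType}.
Variable beta : R.
Hypothesis b1 : 1 < beta.
Variable psi : nat -> R.
Hypothesis psi_gt0 : forall n, 0 < psi n.

Let lnb_gt0 : 0 < ln beta. Proof. by rewrite ln_gt0. Qed.
Let beta_gt0 : 0 < beta. Proof. exact: lt_trans b1. Qed.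

Lemma decay_rate_gt (v : R) n : (0 < n)%N ->
  (v%:E < decay_rate beta psi n)%E = (psi n < beta `^ (- (v * n%:R))).
Proof.
move=> n0; have n0R : 0 < n%:R :> R by rewrite ltr0n.
rewrite /decay_rate lte_fin ltr_pdivlMr // ltrNr ltr_pdivrMr //.
by rewrite -ln_powR ltr_ln ?posrE ?powR_gt0.
Qed.

Lemma decay_rate_lt (v : R) n : (0 < n)%N ->
  (decay_rate beta psi n < v%:E)%E = (beta `^ (- (v * n%:R)) < psi n).
Proof.
move=> n0; have n0R : 0 < n%:R :> R by rewrite ltr0n.
rewrite /decay_rate lte_fin ltr_pdivrMr // ltrNl ltr_pdivlMr //.
by rewrite -ln_powR ltr_ln ?posrE ?powR_gt0.
Qed.

Lemma lower_rateE : lower_rate beta psi = ereal_sup (range (einfs (decay_rate beta psi))).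
Proof. by rewrite /lower_rate limn_einf_lim; apply/cvg_lim => //; exact: cvg_einfs_sup. Qed.

Lemma upper_rateE : upper_rate beta psi = ereal_inf (range (esups (decay_rate beta psi))).
Proof. by rewrite /upper_rate limn_esup_lim; apply/cvg_lim => //; exact: cvg_esups_inf. Qed.

Lemma lower_rate_gt (v : R) : (v%:E < lower_rate beta psi)%E ->
  exists N : nat, forall n, (N <= n)%N -> psi n < beta `^ (- (v * n%:R)).
Proof.
rewrite lower_rateE => /ereal_sup_gt[_ [N _ <-] vN]; exists N.+1 => n Nn.
rewrite -decay_rate_gt; last exact: leq_ltn_trans Nn.
apply: lt_le_trans vN _; apply: ereal_inf_lbound; exists n => //=.
exact: ltnW.
Qed.

Lemma upper_rate_lt (v : R) : (upper_rate beta psi < v%:E)%E ->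
  exists N : nat, forall n, (N <= n)%N -> beta `^ (- (v * n%:R)) < psi n.
Proof.
rewrite upper_rateE => /ereal_inf_lt[_ [N _ <-] vN]; exists N.+1 => n Nn.
rewrite -decay_rate_lt; last exact: leq_ltn_trans Nn.
apply: le_lt_trans vN; apply: ereal_sup_ubound; exists n => //=.
exact: ltnW.
Qed.

Lemma upper_rate_gt (v : R) : (v%:E < upper_rate beta psi)%E ->
  forall N : nat, exists2 n, (N <= n)%N & psi n < beta `^ (- (v * n%:R)).
Proof.
rewrite upper_rateE => vlt N.
have : (v%:E < esups (decay_rate beta psi) N.+1)%E.
  by apply: lt_le_trans vlt _; apply: ereal_inf_lbound; exists N.+1.
move=> /ereal_sup_gt[_ [n /= Nn <-]]; rewrite decay_rate_gt; last exact: leq_ltn_trans Nn.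
by exists n => //; exact: ltnW.
Qed.
End Rates.

Lemma infinite_natP (A : set nat) :
  infinite_set A <-> forall n0, exists2 n, (n0 <= n)%N & A n.
Proof.
split=> [infA n0|cofA].
  apply: contrapT => none; apply: infA; apply: sub_finite_set (finite_II n0).
  by move=> n An /=; rewrite ltnNge; apply/negP => n0n; apply: none; exists n.
move=> /finite_seqP[s As]; have [n] := cofA (\max_(i <- s) i).+1.
rewrite As /= => lt_n ns.
by have := @leq_bigmax_seq _ s xpredT id n ns isT; rewrite leqNgt lt_n.
Qed.

(** * The bounds for the intersection *)

Section Sets.
Context {R : realType}.
Variables (beta : R) (psi1 psi2 : nat -> R).
Hypothesis b1 : 1 < beta.
Hypothesis psi1_gt0 : forall n, 0 < psi1 n.
Hypothesis psi2_gt0 : forall n, 0 < psi2 n.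
Hypothesis v1_ge0 : (0 <= lower_rate beta psi1)%E.
Hypothesis v2_ge0 : (0 <= lower_rate beta psi2)%E.
Local Notation T := (beta_trans beta).
Local Notation LU := (asymp_set beta psi1 `&` unif_set beta psi2).
Local Notation v1l := (lower_rate beta psi1).
Local Notation v1u := (upper_rate beta psi1).
Local Notation v2l := (lower_rate beta psi2).
Local Notation v2u := (upper_rate beta psi2).

Let v1u_ge0 : (0 <= v1u)%E.
Proof. by apply: le_trans v1_ge0 _; exact: limn_einf_sup. Qed.
Let v2u_ge0 : (0 <= v2u)%E.
Proof. by apply: le_trans v2_ge0 _; exact: limn_einf_sup. Qed.

Lemma LU_itv x : LU x -> 0 <= x <= 1.
Proof. by move=> [[]]; rewrite in_itv. Qed.

Lemma LU_asymp x (v : R) : LU x -> (v%:E < v1l)%E -> asymp_rate_ge beta x v.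
Proof.
move=> [[_ /infinite_natP xL] _] /(lower_rate_gt b1 psi1_gt0)[N HN] n0.
have [n nn0 xn] := xL (n0 + N)%N; exists n; first exact: leq_trans (leq_addr _ _) nn0.
by apply: lt_trans xn (HN _ _); exact: leq_trans (leq_addl _ _) nn0.
Qed.

Lemma LU_unif x (w : R) : LU x -> (w%:E < v2l)%E -> unif_rate_ge beta x w.
Proof.
move=> [_ [_ [N0 _ xU]]] /(lower_rate_gt b1 psi2_gt0)[N1 HN1].
exists (N0 + N1)%N => N NN; have [n nN xn] := xU N (leq_trans (leq_addr _ _) NN).
exists n => //; apply: lt_trans xn (HN1 _ _); exact: leq_trans (leq_addl _ _) NN.
Qed.

(** Infinitely many times [N] have a small [psi2 N], and the point is
approximated at a time [n <= N], where the required precision is lower. *)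
Lemma LU_asymp_of_unif x (v : R) : LU x -> (forall n, iter n T x != 0) -> 0 < v ->
  (v%:E < v2u)%E -> asymp_rate_ge beta x v.
Proof.
move=> xLU xnz v0 vv2; have x01 := LU_itv xLU; case: xLU => _ [_ [N0 _ xU]].
apply: asymp_rate_ge_unif => // N1.
have [N NN psiN] := upper_rate_gt b1 psi2_gt0 vv2 (N0 + N1)%N.
have [n nN xn] := xU N (leq_trans (leq_addr _ _) NN).
exists N, n; split => //; first exact: leq_trans (leq_addl _ _) NN.
exact: lt_trans xn psiN.
Qed.

Lemma mem_LU x (v w : R) : (v1u < v%:E)%E -> (v2u < w%:E)%E -> 0 <= x <= 1 ->
  asymp_rate_ge beta x v -> unif_rate_ge beta x w -> LU x.
Proof.
move=> /(upper_rate_lt b1 psi1_gt0)[N1 HN1] /(upper_rate_lt b1 psi2_gt0)[N2 HN2] x01 xv [N0 xw].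
have x01' : x \in `[0, 1] by rewrite in_itv.
split; split => //.
  apply/infinite_natP => n0; have [n nn0 xn] := xv (n0 + N1)%N.
  exists n; first exact: leq_trans (leq_addr _ _) nn0.
  by apply: lt_trans xn (HN1 _ _); exact: leq_trans (leq_addl _ _) nn0.
exists (N0 + N2)%N => // N /= NN; have [n nN xn] := xw N (leq_trans (leq_addr _ _) NN).
exists n => //; apply: lt_trans xn (HN2 _ _); exact: leq_trans (leq_addl _ _) NN.
Qed.

(** A uniform exponent greater than [1] is impossible for an orbit that avoids
[0], and a point whose orbit reaches [0] is the left endpoint of a cylinder. *)
Lemma countable_LU : (1 < v2l)%E -> countable LU.
Proof.
move=> v2l1.
have [v v1 vv2] : exists2 v : R, 1 < v & (v%:E < v2l)%E.
  move: v2l1; case: v2l => [r||//]; rewrite ?lte_fin => r1.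
    by exists ((1 + r) / 2); rewrite ?lte_fin; lra.
  by exists 2; rewrite ?ltry // ltr1n.
have [C _ Clist] := lendpoint_list b1.
have /choice[D HD] : forall n, exists l : seq R, forall x, 0 <= x <= 1 -> lendpoint beta n x \in l.
  by move=> n; have [l _ ?] := Clist n; exists l.
apply: (@sub_countable _ _ _ (\bigcup_n [set` D n])); last first.
  apply: bigcup_countable => // n _; apply: finite_set_countable.
  by apply/finite_seqP; exists (D n).
apply: subset_card_le => x xLU; have x01 := LU_itv xLU.
have [xnz|/existsNP[n /negP/negPn/eqP xn0]] := pselect (forall n, iter n T x != 0).
  have v01 : (0 : R) < 1 < v by rewrite ltr01 v1.
  have [] := asymp_rate_ge_of_unif b1 x01 xnz v01 (LU_unif xLU vv2).
  by rewrite ltxx.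
by exists n => //=; have := HD n x x01; rewrite /lendpoint xn0 mul0r subr0.
Qed.

Lemma dim_LU_le_inv1p (v : \bar R) : (0 <= v)%E ->
  (forall u : R, 0 < u -> (u%:E < v)%E ->
     forall x, LU x -> (forall n, iter n T x != 0) -> asymp_rate_ge beta x u) ->
  (hausdorff_dim LU <= (inv1p v)%:E)%E.
Proof.
case: v => [r||//] r0 HLU; last first.
  apply/lee_addgt0Pr => e e0; rewrite /inv1p add0e.
  have ie : 0 < e^-1 by rewrite invr_gt0.
  apply: le_trans (hausdorff_dim_asymp_le b1 (ltW ie) LU_itv _) _.
    by move=> x xLU xnz; apply: HLU; rewrite ?ltry.
  by rewrite lee_fin ler_pdivrMr ?addr_gt0 // mulrDr mulfV ?gt_eqF //; lra.
rewrite lee_fin in r0; rewrite /inv1p; move: r0; rewrite le_eqVlt => /predU1P[<-|r0].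
  by apply: (hausdorff_dim_asymp_le b1 _ LU_itv) => // *; exact: asymp_rate_ge0.
rewrite -[r]subr0; apply: (@ge_limit_at0 _ (fun e => 1 / (1 + (r - e)))).
  by rational_continuity; rewrite subr0 gt_eqF // addr_gt0.
exists r => // e /andP[e0 er]; apply: (hausdorff_dim_asymp_le b1 _ LU_itv); first lra.
by move=> x xLU xnz; apply: HLU; rewrite ?lte_fin //; lra.
Qed.

Lemma dim_LU_le_unif : (v2l <= 1)%E -> (hausdorff_dim LU <= (unif_bound v2l)%:E)%E.
Proof.
have := LU_unif; move: v2_ge0; case: v2l => [t||//] // t0 Ut t1.
rewrite !lee_fin in t0 t1; rewrite /unif_bound /=.
move: t0; rewrite le_eqVlt => /predU1P[<-|t0].
  apply: le_trans (hausdorff_dim_asymp_le b1 (lexx 0) LU_itv _) _.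
    by move=> *; exact: asymp_rate_ge0.
  by rewrite subr0 addr0 divr1 expr1n.
have -> : t = t - 2 * 0 by ring.
apply: (@ge_limit_at0 _ (fun e => ((1 - (t - 2 * e)) / (1 + (t - 2 * e))) ^+ 2)).
  by rational_continuity; rewrite mulr0 subr0 gt_eqF // addr_gt0.
exists (t / 2) => [|e /andP[e0 et]]; first by rewrite divr_gt0.
apply: (@hausdorff_dim_unif_le _ _ b1 _ (t - 2 * e) (t - e)); [lra|lra|exact: LU_itv|].
by move=> x xLU _; apply: Ut; rewrite ?lte_fin //; lra.
Qed.

Lemma dim_LU_le_joint : (v2l <= (threshold v1l)%:E)%E ->
  (hausdorff_dim LU <= (joint_bound v1l v2l)%:E)%E.
Proof.
have Linv : (hausdorff_dim LU <= (inv1p v1l)%:E)%E.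
  by apply: dim_LU_le_inv1p => // u _ uv x xLU _; exact: LU_asymp xLU uv.
have := LU_unif; have := LU_asymp; move: v1_ge0 v2_ge0 Linv.
case: v1l => [r| |//]; last by move=> _ _ Linv *; exact: Linv.
case: v2l => [t|//|//].
rewrite !lee_fin => r0 t0 Linv Lr Ut; rewrite /threshold => tr.
have r2 : 0 < 2 + r by lra.
have tr' : t * (2 + r) <= r by rewrite -ler_pdivlMr.
rewrite /joint_bound.
have [r00|rn0] := eqVneq r 0.
  have -> : t = 0 by move: tr'; rewrite r00; lra.
  by move: Linv; rewrite r00 eqxx /inv1p addr0 divr1.
have rpos : 0 < r by rewrite lt_def rn0.
rewrite /=.
move: t0; rewrite le_eqVlt => /predU1P[t00|tpos].
  have -> : (r - t - r * t) / ((1 + r) * (r - t)) = 1 / (1 + r).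
    by rewrite -t00; field; rewrite rn0 gt_eqF //; lra.
  exact: Linv.
have tltr : t < r by have := mulr_gt0 tpos rpos; lra.
have t1 : t < 1 by rewrite -(ltr_pM2r rpos) mul1r; lra.
have -> : (r - t - r * t) / ((1 + r) * (r - t)) = joint_dim r (t - 2 * 0).
  by rewrite mulr0 subr0.
apply: (@ge_limit_at0 _ (fun e => joint_dim r (t - 2 * e))).
  by rewrite /joint_dim; rational_continuity; rewrite mulr0 subr0 gt_eqF // mulr_gt0; lra.
exists (t / 2) => [|e /andP[e0 et]]; first by rewrite divr_gt0.
apply: (@hausdorff_dim_joint_le _ _ b1 _ r (t - 2 * e) (t - e)); [lra|lra| |exact: LU_itv|].
  rewrite ler_pdivrMr; last lra.
  by have := mulr_gt0 rpos e0; lra.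
move=> x xLU _; split; first by apply: Ut; rewrite ?lte_fin //; lra.
by move=> v vr; apply: Lr; rewrite ?lte_fin.
Qed.

(** The asymptotic exponent [2 * w / (1 - w)] is the best one for the uniform
exponent [w], and the hypothesis says that it is large enough for [psi1]. *)
Lemma unif_bound_le_dim_LU (r t : R) : v1u = r%:E -> v2u = t%:E -> r * (1 - t) <= 2 * t ->
  t < 1 -> ((unif_bound t%:E)%:E <= hausdorff_dim LU)%E.
Proof.
move=> v1uE v2uE rt t1.
have r0 : 0 <= r by have := v1u_ge0; rewrite v1uE.
have t0 : 0 <= t by have := v2u_ge0; rewrite v2uE.
rewrite /unif_bound /= -[t]addr0.
apply: (@le_limit_at0 _ (fun e => ((1 - (t + e)) / (1 + (t + e))) ^+ 2)).
  by rational_continuity; rewrite addr0 gt_eqF //; lra.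
exists (1 - t) => [|e /andP[e0 et]]; first lra.
pose w := t + e; pose v := 2 * w / (1 - w).
have w0 : 0 < w by rewrite /w; lra.
have w1 : 0 < 1 - w by rewrite /w; lra.
have v0 : 0 < v by rewrite divr_gt0 // mulr_gt0.
have -> : ((1 - w) / (1 + w)) ^+ 2 = joint_dim v w.
  rewrite /joint_dim /v; field.
  apply/and3P; split; rewrite gt_eqF //; last by lra.
  by have -> : 2 * w + - w * (1 - w) = w * (1 + w) by [ring]; rewrite mulr_gt0 // addr_gt0.
apply: (hausdorff_dim_joint_ge b1) => //.
  rewrite /v ltr_pdivlMr //.
  have -> : w * (1 + 2 * w / (1 - w)) * (1 - w) = w * (1 + w) by field; rewrite gt_eqF.
  have := mulr_gt0 w0 w1; lra.
move=> x x01 xv xw; apply: mem_LU x01 xv xw.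
  rewrite v1uE lte_fin /v ltr_pdivlMr // /w.
  by have := mulr_ge0 r0 (ltW e0); lra.
by rewrite v2uE lte_fin /w; lra.
Qed.

Lemma dim_LU_ge_unif : ((threshold v1u)%:E < v2u)%E -> (v2u <= 1)%E ->
  ((unif_bound v2u)%:E <= hausdorff_dim LU)%E.
Proof.
have := unif_bound_le_dim_LU; move: v1u_ge0 v2u_ge0.
case: v2u => [t||//] //; case: v1u => [r||//]; rewrite /threshold !lee_fin ?lte_fin.
- move=> r0 t0 H rt; rewrite le_eqVlt => /predU1P[->|t1].
    by rewrite /unif_bound /= subrr mul0r expr0n /=; exact: hausdorff_dim_ge0.
  apply: (H r t) => //; move: rt; rewrite ltr_pdivrMr; last lra.
  lra.
- by move=> _ _ _ t1; rewrite leNgt t1.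
Qed.

Lemma dim_LU_ge_joint : (v2u <= (threshold v1u)%:E)%E ->
  ((joint_bound v1u v2u)%:E <= hausdorff_dim LU)%E.
Proof.
have := unif_bound_le_dim_LU; have := mem_LU; move: v1u_ge0 v2u_ge0.
case: v1u => [r| |//]; last by move=> *; exact: hausdorff_dim_ge0.
case: v2u => [t|//|//].
rewrite /threshold !lee_fin => r0 t0 HLU H tr.
have r2 : 0 < 2 + r by lra.
have {}tr : t * (2 + r) <= r by rewrite -ler_pdivlMr.
rewrite /joint_bound.
have [r00|rn0] := eqVneq r 0.
  have t00 : t = 0 by move: tr; rewrite r00; lra.
  rewrite t00 eqxx /=.
  have := H r t erefl erefl; rewrite r00 t00 /unif_bound /= subr0 addr0 divr1 expr1n.
  by apply; lra.
have rpos : 0 < r by rewrite lt_def rn0.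
rewrite /=; have gap : 0 < r - t - r * t.
  by move: t0; rewrite le_eqVlt => /predU1P[<-|tpos]; lra.
have tltr : t < r by have := mulr_ge0 r0 t0; lra.
have -> : (r - t - r * t) / ((1 + r) * (r - t)) = joint_dim (r + 0) (t + 0) by rewrite !addr0.
apply: (@le_limit_at0 _ (fun e => joint_dim (r + e) (t + e))).
  by rewrite /joint_dim; rational_continuity; rewrite !addr0 gt_eqF // mulr_gt0; lra.
have c0 : 0 < r + t + 1 by lra.
exists (Num.min 1 ((r - t - r * t) / (r + t + 1))).
  by rewrite lt_min ltr01 /= divr_gt0.
move=> e /andP[e0]; rewrite lt_min => /andP[e1]; rewrite ltr_pdivlMr // => ec.
apply: (hausdorff_dim_joint_ge b1) => //; [lra|lra| |].
  have ee : e * e < e by rewrite gtr_pMr.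
  lra.
by move=> x x01 xv xw; apply: HLU x01 xv xw; rewrite lte_fin; lra.
Qed.
End Sets.

(** * The theorem *)

Theorem theorem2 (R : realType) (beta : R) (psi1 psi2 : nat -> R)
    (hbeta : 1 < beta)
    (hpsi1 : forall n, 0 < psi1 n) (hpsi2 : forall n, 0 < psi2 n)
    (hv1 : (0 <= lower_rate beta psi1)%E)
    (hv2 : (0 <= lower_rate beta psi2)%E) :
  let v1l := lower_rate beta psi1 in
  let v1u := upper_rate beta psi1 in
  let v2l := lower_rate beta psi2 in
  let v2u := upper_rate beta psi2 in
  let LU := asymp_set beta psi1 `&` unif_set beta psi2 in
  let dimLU := hausdorff_dim LU in
  (* (a) *)
  ((1 < v2l)%E -> countable LU) /\
  (* (b) *)
  (((threshold v1u)%:E <= v2l)%E -> (v2l <= 1)%E -> (1 < v2u)%E ->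
    (0 <= dimLU)%E /\
    (dimLU <= (Num.min (inv1p v2u) (unif_bound v2l))%:E)%E) /\
  (* (c) *)
  (((threshold v1l)%:E < v2l)%E -> (v2l <= v2u)%E -> (v2u <= 1)%E ->
   ((threshold v1u)%:E < v2u)%E ->
    ((unif_bound v2u)%:E <= dimLU)%E /\
    (dimLU <= (Num.min (inv1p v2u) (unif_bound v2l))%:E)%E) /\
  (* (d) *)
  ((v2l <= (threshold v1l)%:E)%E ->
   ((threshold v1u)%:E < v2u)%E -> (v2u <= 1)%E ->
    ((unif_bound v2u)%:E <= dimLU)%E /\
    (dimLU <= (joint_bound v1l v2l)%:E)%E) /\
  (* (e) *)
  (((threshold v1l)%:E < v2l)%E -> (v2l <= v2u)%E ->
   (v2u <= (threshold v1u)%:E)%E ->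
    ((joint_bound v1u v2u)%:E <= dimLU)%E /\
    (dimLU <= (Num.min (inv1p v2u) (unif_bound v2l))%:E)%E) /\
  (* (f) *)
  ((v2l <= (threshold v1l)%:E)%E -> (v2u <= (threshold v1u)%:E)%E ->
    ((joint_bound v1u v2u)%:E <= dimLU)%E /\
    (dimLU <= (joint_bound v1l v2l)%:E)%E).
Proof.
move=> v1l v1u v2l v2u LU dimLU.
have v2lu : (v2l <= v2u)%E by exact: limn_einf_sup.
have v2u_ge0 : (0 <= v2u)%E by exact: le_trans v2lu.
have dim_le_min : (v2l <= 1)%E ->
    (dimLU <= (Num.min (inv1p v2u) (unif_bound v2l))%:E)%E.
  move=> v2l1; rewrite EFin_min le_min; apply/andP; split.
    apply: dim_LU_le_inv1p => // u u0 uv x xLU xnz.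
    exact: (LU_asymp_of_unif hbeta hpsi2 xLU).
  exact: dim_LU_le_unif.
have dim_ge_unif : ((threshold v1u)%:E < v2u)%E -> (v2u <= 1)%E ->
    ((unif_bound v2u)%:E <= dimLU)%E by exact: dim_LU_ge_unif.
have dim_ge_joint : (v2u <= (threshold v1u)%:E)%E ->
    ((joint_bound v1u v2u)%:E <= dimLU)%E by exact: dim_LU_ge_joint.
have dim_le_joint : (v2l <= (threshold v1l)%:E)%E ->
    (dimLU <= (joint_bound v1l v2l)%:E)%E by exact: dim_LU_le_joint.
have threshold_le1 (u : \bar R) : (0 <= u)%E -> threshold u <= 1.
  case: u => [r|//|//]; rewrite lee_fin /threshold => r0.
  by rewrite ler_pdivrMr; lra.
split; first exact: countable_LU.
split; first by move=> _ v2l1 _; split; [exact: hausdorff_dim_ge0|exact: dim_le_min].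
split.
  move=> _ _ v2u1 tv; split; first exact: dim_ge_unif.
  by apply: dim_le_min; exact: le_trans v2u1.
split; first by move=> lv tv v2u1; split; [exact: dim_ge_unif|exact: dim_le_joint].
split.
  move=> _ _ v2t; split; first exact: dim_ge_joint.
  apply: dim_le_min; apply: le_trans v2lu (le_trans v2t _).
  rewrite lee_fin; apply: threshold_le1.
  by apply: le_trans hv1 _; exact: limn_einf_sup.
by move=> lv v2t; split; [exact: dim_ge_joint|exact: dim_le_joint].
Qed.
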